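(* Let $\mathcal{G}$ be a class of graphs defined by two forbidden induced subgraphs. Then $\mathcal{G}$ is not equivalent to any class of $(H_1,H_2)$-free graphs satisfying one of the conditions listed below if and only if $\mathcal{G}$ is equivalent to one of the following six classes: $(K_3,P_7)$-free, $(K_3,S_{1,2,3})$-free, $(K_4,S_{1,1,3})$-free, $(\mathrm{diamond},P_1+P_2+P_3)$-free, $(\mathrm{diamond},P_1+P_5)$-free, or $(\mathrm{gem},P_2+P_3)$-free graphs. The listed conditions are: (a) $H_1$ or $H_2 \subseteq_i P_4$; (b) $\overline{H_1}$ and $H_2 \subseteq_i K_{1,t}+P_1$ for some $t\geq 1$; (c) $\overline{H_1}$ and $H_2 \subseteq_i tP_1+P_3$ for some $t\geq 1$; (d) $H_1 \subseteq_i K_t$ and $H_2 \subseteq_i 2K_{1,t}$, $K_{1,t}^+$ or $P_5$ for some $t\geq 1$; (e) $H_1 \subseteq_i \mathrm{paw}$ and $H_2 \subseteq_i P_2+P_4$, $P_6$, $S_{1,2,2}$ or $K_{1,t}^{++}+P_1$ for some $t\geq 1$; (f) $H_1 \subseteq_i \mathrm{diamond}$ and $H_2 \subseteq_i P_1+2P_2$; (g) $H_1 \subseteq_i \mathrm{gem}$ and $H_2 \subseteq_i P_1+P_4$ or $P_5$; (h) $H_1 \subseteq_i \overline{2P_1+P_3}$ and $H_2 \subseteq_i P_2+P_3$ or $P_5$; (i) neither $H_1$ nor $H_2$ is a path star forest; (j) neither $\overline{H_1}$ nor $\overline{H_2}$ is a path star forest; (k) $H_1 \supseteq_i K_3$ and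 $H_2 \supseteq_i 2P_1+2P_2$, $P_1+2P_3$, $2P_1+P_4$ or $3P_2$; (l) $H_1 \supseteq_i K_4$ and $H_2 \supseteq_i K_{1,4}^{++}$, $P_1+2P_2$ or $P_1+P_4$; (m) $H_1 \supseteq_i K_5$ and $H_2 \supseteq_i K_{1,3}^{++}$; (n) $H_1 \supseteq_i C_4$ and $H_2 \supseteq_i K_{1,3}$, $3P_1+P_2$ or $2P_2$; (o) $H_1 \supseteq_i \mathrm{diamond}$ and $H_2 \supseteq_i K_{1,3}$, $P_2+P_4$, $2P_3$ or $P_6$; (p) $H_1 \supseteq_i \mathrm{gem}$ and $H_2 \supseteq_i P_1+2P_2$.
   Context: Conditions (a)–(h) are those under which Graph Isomorphism is known to be polynomial-time solvable on $(H_1,H_2)$-free graphs, and (i)–(p) those under which it is known to be GI-complete; the six listed classes are exactly the remaining open cases. A graph is $(H_1,H_2)$-free if it contains no induced subgraph isomorphic to $H_1$ or $H_2$; $F\subseteq_i G$ means $F$ is an induced subgraph of $G$. Given four graphs $H_1,H_2,H_3,H_4$, the classes of $(H_1,H_2)$-free graphs and $(H_3,H_4)$-free graphs are equivalent if the unordered pair $H_3,H_4$ can be obtained from the unordered pair $H_1,H_2$ by some combination of: (i) complementing both graphs in the pair, and (ii) if one of the graphs in the pair is $K_3$, replacing it with the paw or vice versa. Notation: $C_t,K_t,K_{1,t},P_r$ are the cycle, complete graph, star and path; $G+H$ is disjoint union, $tG$ is $t$ disjoint copies of $G$, $\overline{G}$ is the complement. $K_{1,t}^+$ and $K_{1,t}^{++}$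 are obtained from $K_{1,t}$ by subdividing one edge once or twice, respectively. The paw is $\overline{P_1+P_3}$, the diamond is $\overline{2P_1+P_2}$, the gem is $\overline{P_1+P_4}$. $S_{h,i,j}$ ($1\le h\le i\le j$) is the tree with exactly one vertex $x$ of degree 3 and exactly three leaves, at distances $h,i,j$ from $x$. A path star forest is a graph all of whose components are subdivided stars (stars with edges subdivided arbitrarily many times). *)

(* Defs.v *)
From Stdlib Require Import Relation_Operators.
From mathcomp Require Import all_boot.
Set Implicit Arguments. Unset Strict Implicit. Unset Printing Implicit Defensive.

(* A graph: n vertices {0,..,n-1} and a raw relation on nat; the actual
   (simple, undirected, loopless) adjacency is the symmetric irreflexive
   closure of the raw relation restricted to the vertex set. *)
Record graph := Graph { nv : nat; radj : nat -> nat -> bool }.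

Definition adj (G : graph) (i j : 'I_(nv G)) : bool :=
  (i != j) && (radj G i j || radj G j i).
Arguments adj : clear implicits.

Definition isub (F G : graph) : Prop :=
  exists f : 'I_(nv F) -> 'I_(nv G),
    injective f /\ forall i j, adj G (f i) (f j) = adj F i j.

Definition iso (F G : graph) : Prop :=
  exists f : 'I_(nv F) -> 'I_(nv G),
    bijective f /\ forall i j, adj G (f i) (f j) = adj F i j.

Definition compl (G : graph) : graph :=
  Graph (nv G) (fun i j => ~~ (radj G i j || radj G j i)).

Definition gunion (G H : graph) : graph :=
  Graph (nv G + nv H)
    (fun i j => if i < nv G then (j < nv G) && radj G i j
                else (nv G <= j) && radj H (i - nv G) (j - nv G)).

Definition gempty : graph := Graph 0 (fun _ _ => false).

Definition copies (t : nat) (G : graph) : graph := iter t (gunion G) gempty.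

Definition bigunion (s : seq graph) : graph := foldr gunion gempty s.

Definition P (r : nat) : graph := Graph r (fun i j => j == i.+1).
Definition K (t : nat) : graph := Graph t (fun _ _ => true).
Definition C (t : nat) : graph :=
  Graph t (fun i j => (j == i.+1) || ((i == 0) && (j == t.-1))).

(* subdivided star with arms of lengths ls (vertex 0 is the centre) *)
Definition arm_starts (ls : seq nat) : seq nat :=
  [seq (sumn (take k ls)).+1 | k <- iota 0 (size ls)].
Definition substar (ls : seq nat) : graph :=
  Graph (sumn ls).+1
    (fun i j => if i == 0 then j \in arm_starts ls
                else (j != 0) && radj (bigunion (map P ls)) i.-1 j.-1).

Definition star (t : nat) : graph := substar (nseq t 1).
Definition starp (t : nat) : graph := substar (2 :: nseq t.-1 1).
Definition starpp (t : nat) : graph := substar (3 :: nseq t.-1 1).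
Definition S (h i j : nat) : graph := substar [:: h; i; j].

Definition paw : graph := compl (gunion (P 1) (P 3)).
Definition diamond : graph := compl (gunion (copies 2 (P 1)) (P 2)).
Definition gem : graph := compl (gunion (P 1) (P 4)).

Definition path_star_forest (G : graph) : Prop :=
  exists lss : seq (seq nat),
    all (all (fun l => 0 < l)) lss /\ iso G (bigunion (map substar lss)).

Inductive pair_step : graph * graph -> graph * graph -> Prop :=
  | ps_iso H1 H2 H3 H4 : iso H1 H3 -> iso H2 H4 -> pair_step (H1, H2) (H3, H4)
  | ps_swap H1 H2 : pair_step (H1, H2) (H2, H1)
  | ps_compl H1 H2 : pair_step (H1, H2) (compl H1, compl H2)
  | ps_K3paw H1 H2 : iso H1 (K 3) -> pair_step (H1, H2) (paw, H2)
  | ps_pawK3 H1 H2 : iso H1 paw -> pair_step (H1, H2) (K 3, H2).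

Definition pair_equiv : graph * graph -> graph * graph -> Prop :=
  clos_refl_trans (graph * graph) pair_step.

Definition cond (H1 H2 : graph) : Prop :=
  (* (a) *) (isub H1 (P 4) \/ isub H2 (P 4)) \/
  (* (b) *) (exists t, 1 <= t /\ isub (compl H1) (gunion (star t) (P 1))
                              /\ isub H2 (gunion (star t) (P 1))) \/
  (* (c) *) (exists t, 1 <= t /\ isub (compl H1) (gunion (copies t (P 1)) (P 3))
                              /\ isub H2 (gunion (copies t (P 1)) (P 3))) \/
  (* (d) *) (exists t, 1 <= t /\ isub H1 (K t) /\
               (isub H2 (copies 2 (star t)) \/ isub H2 (starp t) \/ isub H2 (P 5))) \/
  (* (e) *) (isub H1 paw /\
               (isub H2 (gunion (P 2) (P 4)) \/ isub H2 (P 6) \/ isub H2 (S 1 2 2) \/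
                exists t, 1 <= t /\ isub H2 (gunion (starpp t) (P 1)))) \/
  (* (f) *) (isub H1 diamond /\ isub H2 (gunion (P 1) (copies 2 (P 2)))) \/
  (* (g) *) (isub H1 gem /\ (isub H2 (gunion (P 1) (P 4)) \/ isub H2 (P 5))) \/
  (* (h) *) (isub H1 (compl (gunion (copies 2 (P 1)) (P 3))) /\
               (isub H2 (gunion (P 2) (P 3)) \/ isub H2 (P 5))) \/
  (* (i) *) (~ path_star_forest H1 /\ ~ path_star_forest H2) \/
  (* (j) *) (~ path_star_forest (compl H1) /\ ~ path_star_forest (compl H2)) \/
  (* (k) *) (isub (K 3) H1 /\
               (isub (gunion (copies 2 (P 1)) (copies 2 (P 2))) H2 \/
                isub (gunion (P 1) (copies 2 (P 3))) H2 \/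
                isub (gunion (copies 2 (P 1)) (P 4)) H2 \/
                isub (copies 3 (P 2)) H2)) \/
  (* (l) *) (isub (K 4) H1 /\
               (isub (starpp 4) H2 \/ isub (gunion (P 1) (copies 2 (P 2))) H2 \/
                isub (gunion (P 1) (P 4)) H2)) \/
  (* (m) *) (isub (K 5) H1 /\ isub (starpp 3) H2) \/
  (* (n) *) (isub (C 4) H1 /\
               (isub (star 3) H2 \/ isub (gunion (copies 3 (P 1)) (P 2)) H2 \/
                isub (copies 2 (P 2)) H2)) \/
  (* (o) *) (isub diamond H1 /\
               (isub (star 3) H2 \/ isub (gunion (P 2) (P 4)) H2 \/
                isub (copies 2 (P 3)) H2 \/ isub (P 6) H2)) \/
  (* (p) *) (isub gem H1 /\ isub (gunion (P 1) (copies 2 (P 2))) H2).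

Definition open_pairs : seq (graph * graph) :=
  [:: (K 3, P 7); (K 3, S 1 2 3); (K 4, S 1 1 3);
      (diamond, gunion (P 1) (gunion (P 2) (P 3)));
      (diamond, gunion (P 1) (P 5));
      (gem, gunion (P 2) (P 3))].

Fixpoint inP {A : Type} (x : A) (s : seq A) : Prop :=
  if s is y :: s' then x = y \/ inP x s' else False.

(* Main.v *)
(** Write F for the complement of H1 and G for H2.  By (i), (j) and (a) we may
    assume that F and G are path star forests (a forest whose complement is a
    forest is an induced subgraph of P4), and the pair is then symmetric in F
    and G.  A path star forest is a multiset of arm-length lists; sorting them
    shows that it either contains one of the small forests forbidden by a
    hardness condition (k)-(p) or embeds in one of the graphs allowed by (b)-(h).
    Splitting on F embedding in P1+P3, F being edgeless, and F containing 2P2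
    leaves exactly the six open pairs.  Conversely the orbits of the six pairs
    under the equivalence are finite up to isomorphism, and on each member every
    condition is refuted by a finite search; the infinite families in (b)-(e)
    are handled through a forbidden induced subgraph or a small vertex cover. *)

From Stdlib Require Import Relation_Operators Classical.
Require Import Defs.
From mathcomp Require Import all_boot zify.
Set Implicit Arguments. Unset Strict Implicit. Unset Printing Implicit Defensive.

(** * Induced subgraphs *)

(** Complementing the first graph turns the cliques, the diamond, the gem and [C 4] of the hardness
    conditions into 3P_1, 4P_1, 5P_1, 2P_1+P_2, P_1+P_4 and 2P_2, and the paw into P_1+P_3, so
    (b)-(h) and (k)-(p) all speak of small forests or stars in [F] and [G]. A classification only
    bounds a graph from above. Equality with the graph of an open pair is reached by descent: a
    proper induced subgraph lies in a vertex-deleted one, and each of these falls under another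
    condition or a smaller case. The obstacle is that path star forests have arbitrarily many arms
    and components. Containment between unbounded families is argued on coordinates, while
    containment between fixed graphs is decided by a verified backtracking search run by
    [vm_compute]. For the converse, the six open pairs and the two obtained by putting the paw for
    K_3 make 8 pairs; complementing and swapping give 32. *)

Definition nadj (G : graph) (i j : nat) : bool :=
  (i != j) && (radj G i j || radj G j i).

Lemma nadjC G i j : nadj G i j = nadj G j i.
Proof. by rewrite /nadj eq_sym orbC. Qed.

Definition nat_embedding (F G : graph) (f : nat -> nat) : Prop :=
  [/\ forall i, i < nv F -> f i < nv G,
      forall i j, i < nv F -> j < nv F -> f i = f j -> i = j &
      forall i j, i < nv F -> j < nv F -> nadj G (f i) (f j) = nadj F i j].

(** With numbers instead of ordinals, maps between differently built graphs need no casts and [lia]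
    settles the index arithmetic. Values outside the vertex range do not matter, hence the default
    0. *)
Lemma isub_nat F G : isub F G <-> exists f, nat_embedding F G f.
Proof.
split=> [[f [fI fA]]|[f [fB fI fA]]].
  exists (fun n => if insub n is Some i then val (f i) else 0); split=> [i hi|i j hi hj|i j hi hj].
  - by rewrite insubT ltn_ord.
  - by rewrite !insubT => /val_inj/fI[].
  - by rewrite !insubT; exact: (fA (Ordinal hi) (Ordinal hj)).
exists (fun i : 'I_(nv F) => Ordinal (fB i (ltn_ord i))); split=> [i j [] /fI e|i j].
  by apply/val_inj/e.
exact: fA.
Qed.

Lemma isub_refl G : isub G G.
Proof. by exists id; split. Qed.

Lemma isub_trans G F H : isub F G -> isub G H -> isub F H.
Proof.
move=> [f [fI fA]] [g [gI gA]]; exists (g \o f); split; first exact: inj_comp.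
by move=> i j; rewrite /= gA fA.
Qed.

Lemma isub_nv F G : isub F G -> nv F <= nv G.
Proof. by case=> f [/leq_card]; rewrite !card_ord. Qed.

Lemma iso_isub F G : iso F G -> isub F G.
Proof. by case=> f [/bij_inj fI fA]; exists f. Qed.

Lemma isub_anti_iso F G : isub F G -> isub G F -> iso F G.
Proof.
move=> FG GF; case: (FG) => f [fI fA]; exists f; split=> //.
by apply: inj_card_bij => //; rewrite !card_ord isub_nv.
Qed.

Lemma iso_sym F G : iso F G -> iso G F.
Proof.
case=> f [[g fK gK] fA]; exists g; split; first by exists f.
by move=> i j; rewrite -fA !gK.
Qed.

Lemma iso_trans G F H : iso F G -> iso G H -> iso F H.
Proof.
move=> [f [fI fA]] [g [gI gA]]; exists (g \o f); split; first exact: bij_comp.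
by move=> i j; rewrite /= gA fA.
Qed.

Lemma nadj_compl G i j : nadj (compl G) i j = (i != j) && ~~ nadj G i j.
Proof.
rewrite /nadj /= [radj G j i || _]orbC orbb.
by case: (i != j).
Qed.

Lemma isub_compl F G : isub F G -> isub (compl F) (compl G).
Proof.
move=> /isub_nat[f [fB fI fA]]; apply/isub_nat; exists f; split=> // i j hi hj.
rewrite !nadj_compl fA //; congr (~~ _ && _).
by apply/eqP/eqP => [/fI->|->].
Qed.

Lemma isub_complK G : isub (compl (compl G)) G.
Proof.
apply/isub_nat; exists id; split=> // i j _ _.
rewrite !nadj_compl /nadj; by case: (i != j); rewrite //= negbK.
Qed.

Lemma isub_complKV G : isub G (compl (compl G)).
Proof.
apply/isub_nat; exists id; split=> // i j _ _.
rewrite !nadj_compl /nadj; by case: (i != j); rewrite //= negbK.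
Qed.

Lemma iso_compl F G : iso F G -> iso (compl F) (compl G).
Proof.
move=> h; apply: isub_anti_iso; apply/isub_compl/iso_isub => //; exact: iso_sym.
Qed.

Lemma iso_complK G : iso (compl (compl G)) G.
Proof. exact: isub_anti_iso (isub_complK G) (isub_complKV G). Qed.

Lemma nadj_gunion G H i j :
  nadj (gunion G H) i j =
  if i < nv G then (j < nv G) && nadj G i j
  else (nv G <= j) && nadj H (i - nv G) (j - nv G).
Proof.
rewrite /nadj /=; case: (ltnP i (nv G)) => hi; case: (ltnP j (nv G)) => hj //=.
- by rewrite andbF.
- by rewrite andbF.
by congr (~~ _ && _); apply/eqP/eqP; lia.
Qed.

Lemma gunion_mono F G F' G' : isub F F' -> isub G G' -> isub (gunion F G) (gunion F' G').
Proof.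
move=> /isub_nat[f [fB fI fA]] /isub_nat[g [gB gI gA]]; apply/isub_nat.
exists (fun i => if i < nv F then f i else nv F' + g (i - nv F)); split=> /=.
- move=> i hi; case: (ltnP i (nv F)) => h; first by have := fB _ h; lia.
  by have := gB (i - nv F) ltac:(lia); lia.
- move=> i j hi hj; case: (ltnP i (nv F)) => h; case: (ltnP j (nv F)) => h'; first exact: fI.
  + by have := fB _ h; lia.
  + by have := fB _ h'; lia.
  move=> e; have := gI (i - nv F) (j - nv F) ltac:(lia) ltac:(lia) ltac:(lia); lia.
move=> i j hi hj; rewrite !nadj_gunion; case: (ltnP i (nv F)) => h; case: (ltnP j (nv F)) => h' /=.
- by rewrite !fB // fA.
- by rewrite fB //; case: ltnP => //; lia.
- by have := fB _ h'; do 2!(case: ltnP => ? /=; try lia).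
case: ltnP => ?; first lia.
rewrite leq_addr !addKn gA //; lia.
Qed.

(** A one-component [forest] is literally a [gunion] with [gempty]; this lemma and the next add and
    remove that empty tail. *)
Lemma isub_gunion0 G : isub G (gunion G gempty).
Proof.
apply/isub_nat; exists id; split=> //= i j; first lia.
by move=> hi hj; rewrite nadj_gunion hi hj.
Qed.

Lemma gunion0_isub G : isub (gunion G gempty) G.
Proof.
apply/isub_nat; exists id; split=> //= i j; first lia.
by move=> hi hj; rewrite nadj_gunion; rewrite addn0 in hi hj; rewrite hi hj.
Qed.

(** * Deciding induced subgraphs by backtracking *)

Definition adj_table (G : graph) : seq (seq bool) :=
  mkseq (fun i => mkseq (nadj G i) (nv G)) (nv G).
Definition entry (t : seq (seq bool)) (i j : nat) : bool := nth false (nth [::] t i) j.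

Lemma entryE G i j : i < nv G -> j < nv G -> entry (adj_table G) i j = nadj G i j.
Proof. by move=> hi hj; rewrite /entry !nth_mkseq. Qed.

Definition fits (tF tG : seq (seq bool)) (s : seq nat) (v : nat) : bool :=
  all (fun i => (nth 0 s i != v) && (entry tG (nth 0 s i) v == entry tF i (size s)))
      (iota 0 (size s)).

(* Backtracking: [s] lists the images of the first [size s] vertices of the
   small graph, [r] vertices remain to be placed. *)
Fixpoint extend (tF tG : seq (seq bool)) (vs : seq nat) (r : nat) (s : seq nat) : bool :=
  if r is r'.+1
  then has (fun v => if fits tF tG s v then extend tF tG vs r' (rcons s v) else false) vs
  else true.

(** Both adjacency tables are computed once, so the search does not re-evaluate the nested relations
    of unions and complements. *)
Definition isubb (F G : graph) : bool :=
  extend (adj_table F) (adj_table G) (iota 0 (nv G)) (nv F) [::].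

Definition partial_embedding F G (s : seq nat) : Prop :=
  (forall i, i < size s -> nth 0 s i < nv G) /\
  (forall i j, i < j -> j < size s ->
     nth 0 s i != nth 0 s j /\ nadj G (nth 0 s i) (nth 0 s j) = nadj F i j).

Lemma extend_sound F G r s : size s + r = nv F -> partial_embedding F G s ->
  extend (adj_table F) (adj_table G) (iota 0 (nv G)) r s ->
  exists2 t, size t = nv F & partial_embedding F G t.
Proof.
elim: r s => [|r IH] s /= hs gs; first by exists s => //; lia.
case/hasP=> v; rewrite mem_iota => /= hv; case: ifP => // /allP hf.
apply: IH; first by rewrite size_rcons; lia.
case: gs => gB gA; split=> [i|i j hij]; rewrite size_rcons ltnS.
  by rewrite leq_eqVlt nth_rcons => /orP[/eqP->|hi]; rewrite ?ltnn ?eqxx // hi gB.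
rewrite leq_eqVlt !nth_rcons => /orP[/eqP hj|hj]; last by rewrite hj (ltn_trans hij hj); apply: gA.
rewrite {}hj in hij *; rewrite ltnn eqxx hij.
have /andP[h1 /eqP h2] := hf i ltac:(rewrite mem_iota; lia).
split=> //; move: h2; rewrite !entryE //; try lia; exact: gB.
Qed.

(** The search cannot fail while the prefix agrees with [f]: the image of the next vertex is among
    the candidates and passes [fits]. *)
Lemma extend_complete F G f r s : nat_embedding F G f ->
  size s + r = nv F -> (forall i, i < size s -> nth 0 s i = f i) ->
  extend (adj_table F) (adj_table G) (iota 0 (nv G)) r s.
Proof.
case=> fB fI fA; elim: r s => [|r IH] //= s hs hf.
apply/hasP; exists (f (size s)); first by rewrite mem_iota /= add0n fB //; lia.
have -> : fits (adj_table F) (adj_table G) s (f (size s)).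
  apply/allP=> i; rewrite mem_iota /= add0n => hi; rewrite hf // !entryE ?fA ?eqxx ?andbT; try lia.
  - by apply/eqP=> /fI; lia.
  - by apply: fB; lia.
  - by apply: fB; lia.
apply: IH; first by rewrite size_rcons; lia.
move=> i; rewrite size_rcons ltnS leq_eqVlt nth_rcons => /orP[/eqP->|hi].
  by rewrite ltnn eqxx.
by rewrite hi hf.
Qed.

Lemma isubP F G : reflect (isub F G) (isubb F G).
Proof.
apply: (iffP idP) => [/extend_sound|/isub_nat[f fE]]; last exact: (extend_complete fE).
case=> [||s hs [gB gA]]; rewrite ?add0n //.
apply/isub_nat; exists (nth 0 s); split=> [i hi|i j hi hj|i j hi hj].
- by apply: gB; rewrite hs.
- move=> e; case: (ltngtP i j) => // h.
    by have [] := gA _ _ h ltac:(by rewrite hs); rewrite e eqxx.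
  by have [] := gA _ _ h ltac:(by rewrite hs); rewrite e eqxx.
case: (ltngtP i j) => [h|h|->].
- by have [] := gA _ _ h ltac:(by rewrite hs).
- by rewrite nadjC [RHS]nadjC; have [] := gA _ _ h ltac:(by rewrite hs).
by rewrite /nadj !eqxx.
Qed.

Ltac isub_compute := apply/isubP; vm_compute; reflexivity.

Definition isob (F G : graph) : bool := (nv F == nv G) && isubb F G && isubb G F.

Lemma isoP F G : reflect (iso F G) (isob F G).
Proof.
apply: (iffP idP) => [/andP[/andP[_ /isubP h] /isubP h']|h]; first exact: isub_anti_iso.
have h1 := iso_isub h; have h2 := iso_isub (iso_sym h).
rewrite /isob eqn_leq !isub_nv //=; apply/andP; split; exact/isubP.
Qed.

Ltac iso_compute := apply/isoP; vm_compute; reflexivity.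

Definition del (v : nat) (G : graph) : graph :=
  Graph (nv G).-1 (fun i j => radj G (bump v i) (bump v j)).

Lemma isub_del F G v : v < nv G ->
  (exists2 f, nat_embedding F G f & forall i, i < nv F -> f i != v) -> isub F (del v G).
Proof.
move=> hv [f [fB fI fA] fv]; apply/isub_nat; exists (fun i => unbump v (f i)).
split=> /= [i hi|i j hi hj e|i j hi hj].
- by have := fB _ hi; have := fv _ hi; rewrite /unbump; lia.
- apply: fI => //; have := fv _ hi; have := fv _ hj; move: e; rewrite /unbump; lia.
rewrite -fA // /nadj /= !unbumpK ?inE ?fv //; congr (~~ _ && _).
have := fv _ hi; have := fv _ hj; rewrite /unbump => ? ?; apply/eqP/eqP; lia.
Qed.

(** An embedding that misses a vertex [v] lands in [del v G], and one that misses none is an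
    isomorphism. The hypothesis is checked by computation, which makes this the descent step from an
    upper bound to its smaller cases. *)
Lemma isub_proper (Cs : seq graph) F G :
  all (fun v => has (isubb (del v G)) Cs) (iota 0 (nv G)) ->
  isub F G -> isub G F \/ exists2 i, i < size Cs & isub F (nth gempty Cs i).
Proof.
move=> /allP hC /isub_nat[f fE]; case: (fE) => fB fI fA.
case: (boolP (all (fun v => v \in [seq f i | i <- iota 0 (nv F)]) (iota 0 (nv G)))) => [|/allPn[v]].
  move=> /allP h; left.
  have FG : isub F G by apply/isub_nat; exists f.
  have hn : nv G <= nv F.
    have := @uniq_leq_size _ (iota 0 (nv G)) _ (iota_uniq _ _) h.
    by rewrite size_map !size_iota.
  case: FG => g [gI gA]; have gb : bijective g by apply: inj_card_bij => //; rewrite !card_ord.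
  by apply/iso_isub/iso_sym; exists g.
rewrite mem_iota /= add0n => hv hf; right.
have : isub F (del v G).
  apply: isub_del => //; exists f => // i hi; apply: contra hf => /eqP <-.
  by rewrite map_f // mem_iota.
have /(has_nthP gempty)[i hi /isubP h] := hC v ltac:(by rewrite mem_iota).
by move=> h'; exists i => //; apply: isub_trans h' h.
Qed.

(** * Coordinates on path star forests *)

(** [reshape_index] and [reshape_offset] give the block of a number and its place in that block,
    which is exactly how an iterated [gunion] numbers its vertices. *)
Lemma reshape_index_cons n ns i :
  reshape_index (n :: ns) i = if i < n then 0 else (reshape_index ns (i - n)).+1.
Proof.
rewrite /reshape_index /=; case: ltnP => h.
  by have -> : i.+1 - n == 0 by lia.
have -> : i.+1 - n == 0 = false by lia.
by rewrite subSn.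
Qed.

Lemma reshape_offset_cons n ns i :
  reshape_offset (n :: ns) i = if i < n then i else reshape_offset ns (i - n).
Proof.
rewrite /reshape_offset reshape_index_cons; case: ltnP => h /=; first by rewrite subn0.
lia.
Qed.

Lemma nv_bigunion Gs : nv (bigunion Gs) = sumn (map nv Gs).
Proof. by elim: Gs => //= G Gs ->. Qed.

Lemma nadj_bigunion Gs i j :
  i < nv (bigunion Gs) -> j < nv (bigunion Gs) ->
  let ns := map nv Gs in
  nadj (bigunion Gs) i j =
    (reshape_index ns i == reshape_index ns j) &&
    nadj (nth gempty Gs (reshape_index ns i)) (reshape_offset ns i) (reshape_offset ns j).
Proof.
elim: Gs i j => [|G Gs IH] i j //= hi hj.
rewrite nadj_gunion !reshape_index_cons !reshape_offset_cons.
case: (ltnP i (nv G)) => h; case: (ltnP j (nv G)) => h' //=.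
by rewrite eqSS IH //; lia.
Qed.

Lemma arm_starts_cons l ls : arm_starts (l :: ls) = 1 :: map (addn l) (arm_starts ls).
Proof.
rewrite /arm_starts /=; congr (_ :: _); rewrite (iotaDl 1 0) -!map_comp.
by apply: eq_map => k /=; rewrite addnS.
Qed.

Lemma mem_arm_starts ls i : i < sumn ls ->
  (i.+1 \in arm_starts ls) = (reshape_offset ls i == 0).
Proof.
elim: ls i => [|l ls IH] i //= hi.
rewrite arm_starts_cons inE reshape_offset_cons eqSS; case: ltnP => h.
  case: eqP => //= _; apply/negbTE/mapP => -[k].
  by rewrite /arm_starts => /mapP[k' _ ->]; lia.
have -> : i.+1 = l + (i - l).+1 by lia.
rewrite mem_map; last by move=> a b /addnI.
rewrite IH; last lia.
(* The surviving case [i = 0] forces [l = 0]: the first arm is empty, and vertex 1 starts a later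
   arm. *)
case: eqP => //= i0; have -> : i - l = 0 by lia.
have hl : 0 < sumn ls by lia.
symmetry; apply/eqP; rewrite /reshape_offset; lia.
Qed.

(** A component index, then [None] for the centre, or an arm and a position on it counted from 0 at
    the neighbour of the centre. *)
Definition coord := (nat * option (nat * nat))%type.

Definition spoke_valid (ls : seq nat) (o : option (nat * nat)) : bool :=
  if o is Some (k, p) then p < nth 0 ls k else true.
Definition spoke_adj (o o' : option (nat * nat)) : bool :=
  match o, o' with
  | None, None => false
  | None, Some (_, p) => p == 0
  | Some (_, p), None => p == 0
  | Some (k, p), Some (k', p') => (k == k') && ((p' == p.+1) || (p == p'.+1))
  end.
Definition spoke (ls : seq nat) (i : nat) : option (nat * nat) :=
  if i is i'.+1 then Some (reshape_index ls i', reshape_offset ls i') else None.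
Definition unspoke (ls : seq nat) (o : option (nat * nat)) : nat :=
  if o is Some (k, p) then (flatten_index ls k p).+1 else 0.

Lemma spoke_validP ls i : i < nv (substar ls) -> spoke_valid ls (spoke ls i).
Proof. by case: i => //= i hi; apply: reshape_offsetP. Qed.

Lemma spokeK ls i : unspoke ls (spoke ls i) = i.
Proof. by case: i => //= i; rewrite reshape_indexK. Qed.

Lemma unspokeK ls o : spoke_valid ls o -> unspoke ls o < nv (substar ls) /\ spoke ls (unspoke ls o) = o.
Proof.
case: o => [[k p]|] //= hp; rewrite flatten_indexKl // flatten_indexKr // ltnS.
by split=> //; apply: flatten_indexP.
Qed.

Lemma nadj_path r i j : nadj (P r) i j = (j == i.+1) || (i == j.+1).
Proof. by rewrite /nadj /=; apply/idP/idP; lia. Qed.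

Lemma nadj_substar ls i j : i < nv (substar ls) -> j < nv (substar ls) ->
  nadj (substar ls) i j = spoke_adj (spoke ls i) (spoke ls j).
Proof.
have nvP : map nv (map P ls) = ls by rewrite -map_comp map_id_in.
case: i => [|i]; case: j => [|j] //= hi hj.
- by rewrite /nadj /= orbF mem_arm_starts.
- by rewrite /nadj /= mem_arm_starts.
transitivity (nadj (bigunion (map P ls)) i j); first by rewrite /nadj /= eqSS.
rewrite nadj_bigunion ?nv_bigunion nvP //; congr (_ && _).
rewrite (nth_map 0) ?nadj_path //.
exact: reshape_indexP.
Qed.

Definition forest (lss : seq (seq nat)) : graph := bigunion (map substar lss).

Definition coord_valid (lss : seq (seq nat)) (x : coord) : bool :=
  (x.1 < size lss) && spoke_valid (nth [::] lss x.1) x.2.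
Definition coord_adj (x y : coord) : bool := (x.1 == y.1) && spoke_adj x.2 y.2.

Definition sizes (lss : seq (seq nat)) : seq nat := map nv (map substar lss).
Definition tocoord (lss : seq (seq nat)) (i : nat) : coord :=
  let c := reshape_index (sizes lss) i in
  (c, spoke (nth [::] lss c) (reshape_offset (sizes lss) i)).
Definition ofcoord (lss : seq (seq nat)) (x : coord) : nat :=
  flatten_index (sizes lss) x.1 (unspoke (nth [::] lss x.1) x.2).

Lemma nth_sizes lss c : c < size lss -> nth 0 (sizes lss) c = nv (substar (nth [::] lss c)).
Proof. by move=> h; rewrite /sizes -map_comp (nth_map [::]). Qed.

Lemma size_sizes lss : size (sizes lss) = size lss.
Proof. by rewrite !size_map. Qed.

Lemma tocoord_valid lss i : i < nv (forest lss) -> coord_valid lss (tocoord lss i).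
Proof.
rewrite nv_bigunion -/(sizes _) => hi.
have hc : reshape_index (sizes lss) i < size lss.
  by rewrite -size_sizes reshape_indexP.
by rewrite /coord_valid hc spoke_validP // -nth_sizes // reshape_offsetP.
Qed.

Lemma tocoordK lss i : ofcoord lss (tocoord lss i) = i.
Proof. by rewrite /ofcoord /= spokeK reshape_indexK. Qed.

Lemma ofcoordK lss x : coord_valid lss x ->
  ofcoord lss x < nv (forest lss) /\ tocoord lss (ofcoord lss x) = x.
Proof.
case: x => c o /andP[/= hc] /unspokeK[hu eu].
rewrite nv_bigunion -/(sizes _) /tocoord /ofcoord /=.
rewrite flatten_indexKl ?nth_sizes // flatten_indexKr ?nth_sizes // eu.
by split=> //; apply: flatten_indexP; rewrite nth_sizes.
Qed.

Lemma nadj_forest lss i j : i < nv (forest lss) -> j < nv (forest lss) ->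
  nadj (forest lss) i j = coord_adj (tocoord lss i) (tocoord lss j).
Proof.
move=> hi hj; rewrite nadj_bigunion // -/(sizes _) /coord_adj /tocoord /=.
have := hi; have := hj; rewrite nv_bigunion -/(sizes _) => /reshape_offsetP oj /reshape_offsetP oi.
have ci : reshape_index (sizes lss) i < size lss by case/andP: (tocoord_valid hi).
case: eqP => //= e; rewrite -e in oj *.
by rewrite (nth_map [::]) // nadj_substar -?nth_sizes // ltnS; move: oi oj; rewrite nth_sizes.
Qed.

(** Embeddings between forests of unbounded size can thus be given as maps of coordinates, with no
    arithmetic on vertex numbers. *)
Lemma forest_isub lss lss' (g : coord -> coord) :
  (forall x, coord_valid lss x -> coord_valid lss' (g x)) ->
  (forall x y, coord_valid lss x -> coord_valid lss y -> g x = g y -> x = y) ->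
  (forall x y, coord_valid lss x -> coord_valid lss y -> coord_adj (g x) (g y) = coord_adj x y) ->
  isub (forest lss) (forest lss').
Proof.
move=> gV gI gA; apply/isub_nat; exists (fun i => ofcoord lss' (g (tocoord lss i))).
split=> [i hi|i j hi hj e|i j hi hj].
- by have [] := ofcoordK (gV _ (tocoord_valid hi)).
- rewrite -[i](tocoordK lss) -[j](tocoordK lss); congr ofcoord.
  apply: gI; try exact: tocoord_valid.
  by rewrite -(ofcoordK (gV _ (tocoord_valid hi))).2 e (ofcoordK (gV _ (tocoord_valid hj))).2.
have [bi ei] := ofcoordK (gV _ (tocoord_valid hi)).
have [bj ej] := ofcoordK (gV _ (tocoord_valid hj)).
by rewrite nadj_forest // ei ej gA ?tocoord_valid // -nadj_forest.
Qed.

Fixpoint arms_le (a b : seq nat) : bool :=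
  match a, b with
  | [::], _ => true
  | x :: a', y :: b' => (x <= y) && arms_le a' b'
  | _, _ => false
  end.
Fixpoint forest_le (a b : seq (seq nat)) : bool :=
  match a, b with
  | [::], _ => true
  | x :: a', y :: b' => arms_le x y && forest_le a' b'
  | _, _ => false
  end.

Lemma arms_le_nth a b : arms_le a b -> forall k, nth 0 a k <= nth 0 b k.
Proof.
elim: a b => [|x a IH] [|y b] //=; try by move=> _ k; rewrite nth_nil.
by case/andP=> xy /IH h [].
Qed.

Lemma forest_leP a b : forest_le a b -> isub (forest a) (forest b).
Proof.
move=> ab; apply: (@forest_isub _ _ id) => // -[c o] /andP[/= hc ho].
have [hs hn] : size a <= size b /\ forall c, arms_le (nth [::] a c) (nth [::] b c).
  elim: a b ab {hc ho} => [|x a IH] [|y b] //=; try by split=> // c'; rewrite nth_nil.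
  case/andP=> xy /IH[h1 h2]; split=> //; by case.
rewrite /coord_valid (leq_trans hc hs) /=.
by case: o ho => [[k p]|] //= hp; apply: leq_trans hp (arms_le_nth (hn c) k).
Qed.

(** [sg] sends components to components and [ta] arms to arms that are at least as long. Positions
    on an arm are kept, so adjacency is preserved. *)
Lemma forest_reindex lss lss' (sg : nat -> nat) (ta : nat -> nat -> nat) :
  (forall c, c < size lss -> sg c < size lss') ->
  (forall c d, c < size lss -> d < size lss -> sg c = sg d -> c = d) ->
  (forall c k, c < size lss -> k < size (nth [::] lss c) ->
     nth 0 (nth [::] lss c) k <= nth 0 (nth [::] lss' (sg c)) (ta c k)) ->
  (forall c k l, c < size lss -> k < size (nth [::] lss c) -> l < size (nth [::] lss c) ->
     ta c k = ta c l -> k = l) ->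
  isub (forest lss) (forest lss').
Proof.
move=> sB sI tB tI.
(* An arm index out of range reads the default length 0, which has no valid position. *)
have small ls k p : p < nth 0 ls k -> k < size ls.
  by case: (ltnP k (size ls)) => // h; rewrite nth_default.
apply: (@forest_isub _ _ (fun x => (sg x.1, if x.2 is Some (k, p) then Some (ta x.1 k, p) else None))).
- move=> [c o] /andP[/= hc ho]; rewrite /coord_valid /= sB //=.
  case: o ho => [[k p]|] //= hp; apply: (leq_trans hp); apply: tB => //; exact: small hp.
- move=> [c o] [d o'] /andP[/= hc ho] /andP[/= hd ho'] [/sI e].
  rewrite -{}e // in ho' *; case: o ho => [[k p]|]; case: o' ho' => [[l q]|] //= ? ? [/tI e ->].
  by rewrite e //; apply: small; eassumption.
move=> [c o] [d o'] /andP[/= hc ho] /andP[/= hd ho']; rewrite /coord_adj /=.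
have -> : (sg c == sg d) = (c == d) by apply/eqP/eqP=> [/sI->|->].
case: eqP => //= e; rewrite -{}e in ho' *.
case: o ho => [[k p]|]; case: o' ho' => [[l q]|] //= h h'; congr (_ && _).
by apply/eqP/eqP=> [/tI->|->] //; apply: small; eassumption.
Qed.

Lemma perm_index (T : eqType) (x0 : T) (s t : seq T) : perm_eq s t ->
  exists2 I : nat -> nat,
    (forall i j, i < size s -> j < size s -> I i = I j -> i = j) &
    forall i, i < size s -> I i < size t /\ nth x0 s i = nth x0 t (I i).
Proof.
move=> /(perm_iotaP x0)[Is /[dup] hp /perm_uniq]; rewrite iota_uniq => uI ->.
exists (nth 0 Is) => [i j|i]; rewrite size_map => hi.
  by move=> hj /eqP; rewrite nth_uniq // => /eqP.
rewrite (nth_map 0) //; split=> //.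
by have := mem_nth 0 hi; rewrite (perm_mem hp) mem_iota.
Qed.

Lemma forest_perm lss lss' : perm_eq lss lss' -> isub (forest lss) (forest lss').
Proof.
move=> /(perm_index [::])[I II IB]; apply: (@forest_reindex _ _ I (fun _ => id)) => // [c hc|c k hc hk].
  by have [] := IB c hc.
by have [_ ->] := IB c hc.
Qed.

Lemma arms_perm ls ls' : perm_eq ls ls' -> isub (forest [:: ls]) (forest [:: ls']).
Proof.
move=> /(perm_index 0)[I II IB].
apply: (@forest_reindex _ _ id (fun _ => I)) => // -[|c] //= k => [|l] hc hk.
  by have [_ ->] := IB k hk.
exact: II.
Qed.

Lemma gunion_comm F G : isub (gunion F G) (gunion G F).
Proof.
apply/isub_nat; exists (fun i => if i < nv F then nv G + i else i - nv F); split=> /=.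
- move=> i hi; case: (ltnP i (nv F)) => h; lia.
- move=> i j hi hj; case: (ltnP i (nv F)) => h; case: (ltnP j (nv F)) => h'; lia.
move=> i j hi hj; rewrite !nadj_gunion; case: (ltnP i (nv F)) => h; case: (ltnP j (nv F)) => h' /=.
- by (case: ltnP => ? /=; first lia); rewrite leq_addr !addKn.
- by (case: ltnP => ? /=; first lia); case: leqP => //; lia.
- case: ltnP => ? /=; last lia.
  by case: ltnP => //; lia.
case: ltnP => ? /=; last lia.
by case: ltnP => //; lia.
Qed.

Lemma substar_forest ls ls' : isub (forest [:: ls]) (forest [:: ls']) -> isub (substar ls) (substar ls').
Proof.
move=> h; apply: isub_trans (isub_gunion0 _) _.
exact: isub_trans h (gunion0_isub _).
Qed.

(** Numbers the path from the tip of arm 0: that arm comes first, reversed, then the centre at the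
    length of arm 0, then arm 1. [path_at] goes back. *)
Definition path_pos (ls : seq nat) (o : option (nat * nat)) : nat :=
  let x := nth 0 ls 0 in
  if o is Some (k, p) then if k is 0 then x.-1 - p else x.+1 + p else x.
Definition path_at (ls : seq nat) (m : nat) : option (nat * nat) :=
  let x := nth 0 ls 0 in
  if m < x then Some (0, x.-1 - m) else if m == x then None else Some (1, m - x.+1).

(* With at most two arms the substar is a path; only its length matters. *)
Lemma path_rebalance ls ls' : size ls <= 2 -> size ls' <= 2 -> sumn ls = sumn ls' ->
  isub (forest [:: ls]) (forest [:: ls']).
Proof.
have sum2 s : size s <= 2 -> sumn s = nth 0 s 0 + nth 0 s 1.
  by case: s => [|x [|y []]] //= _; lia.
have val2 s c o : size s <= 2 -> coord_valid [:: s] (c, o) ->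
    c = 0 /\ if o is Some (k, p) then k < 2 /\ p < nth 0 s k else True.
  move=> hs /andP[/=]; case: c => //= _ ho; split=> //.
  case: o ho => [[k p]|] //= ho; split=> //; apply: leq_trans hs; rewrite ltnNge.
  by apply/negP => h; rewrite nth_default in ho.
have atK m : path_pos ls' (path_at ls' m) = m.
  by rewrite /path_at; case: ltnP => ? /=; [lia | case: eqP => ? /=; lia].
move=> hs hs'; rewrite (sum2 _ hs) (sum2 _ hs') => e.
apply: (@forest_isub _ _ (fun x => (0, path_at ls' (path_pos ls x.2)))).
- move=> [c o] /(val2 _ _ _ hs)[-> ho]; rewrite /coord_valid /= /path_at.
  case: ltnP => h /=; first lia.
  case: eqP => //= h'; move: h h'; rewrite /path_pos.
  by case: o ho => [[[|[|k]] p]|] /= ho; lia.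
- move=> [c o] [d o'] /(val2 _ _ _ hs)[-> ho] /(val2 _ _ _ hs)[-> ho'] [h].
  have {h} : path_pos ls o = path_pos ls o'.
    by rewrite -(atK (path_pos ls o)) h atK.
  rewrite /path_pos; case: o ho => [[[|[|k]] p]|] /= ho; case: o' ho' => [[[|[|k']] p']|] /= ho' h;
  first [lia | by [] | by congr (_, Some (_, _)); lia].
move=> [c o] [d o'] /(val2 _ _ _ hs)[-> ho] /(val2 _ _ _ hs)[-> ho'].
rewrite /coord_adj /=.
have at_adj i j : i <= nth 0 ls' 0 + nth 0 ls' 1 -> j <= nth 0 ls' 0 + nth 0 ls' 1 ->
    spoke_adj (path_at ls' i) (path_at ls' j) = (j == i.+1) || (i == j.+1).
  by move=> hi hj; rewrite /path_at; do 2!case: ltnP => ?; do ?case: eqP => ? /=; apply/idP/idP; lia.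
rewrite at_adj /path_pos.
- by case: o ho => [[[|[|k]] p]|] /= ho; case: o' ho' => [[[|[|k']] p']|] /= ho'; apply/idP/idP; lia.
- by case: o ho => [[[|[|k]] p]|] /= ho; lia.
by case: o' ho' => [[[|[|k]] p]|] /= ho'; lia.
Qed.

(** A path has many arm lists with at most two arms. The last clause keeps one of them: [[::]] for
    P_1, [[:: 1]] for P_2, and second arm 1 for longer paths. *)
Definition normal_arms (ls : seq nat) : bool :=
  [&& sorted geq ls, all (leq 1) ls &
      match ls with [:: x] => x == 1 | [:: _; y] => y == 1 | _ => true end].

Lemma normal_armsP ls : all (leq 1) ls ->
  exists2 ls', normal_arms ls' & isub (substar ls) (substar ls') /\ isub (substar ls') (substar ls).
Proof.
case: ls => [|x [|y [|z r]]] hp.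
- by exists [::] => //; split; apply: isub_refl.
- case: x hp => [|[|x]] // _; first by exists [:: 1] => //; split; apply: isub_refl.
  by exists [:: x.+1; 1] => //; split; apply/substar_forest/path_rebalance => //=; lia.
- case: x y hp => [|x] [|y] // _.
  exists [:: (x + y).+1; 1] => //; split; apply/substar_forest/path_rebalance => //=; lia.
set s := [:: x, y, z & r] in hp *; exists (sort geq s).
  have: 2 < size (sort geq s) by rewrite size_sort.
  rewrite /normal_arms sort_sorted ?all_sort ?hp; last by move=> a b; rewrite /geq /=; lia.
  by case: (sort geq s) => [|? [|? []]].
have h : perm_eq (sort geq s) s by rewrite perm_sort.
by split; apply/substar_forest/arms_perm; rewrite // perm_sym.
Qed.

(** In a normal list the head is the longest arm, and components are ordered by it alone. *)
Definition head_geq (a b : seq nat) : bool := head 0 b <= head 0 a.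

Definition normal_components (ns : seq (seq nat)) : bool :=
  all normal_arms ns && all (fun c => c != [::]) ns && sorted head_geq ns.

(** Isolated vertices are split off as [nseq a [::]], because the obstructions count them
    separately; every component left in [ns] has an edge. *)
Lemma psf_normal G : path_star_forest G ->
  exists ns a, [/\ normal_components ns,
    isub G (forest (ns ++ nseq a [::])) & isub (forest (ns ++ nseq a [::])) G].
Proof.
case=> lss [hp /[dup] /iso_isub GL /iso_sym/iso_isub LG].
have [mss hm [LM ML]] : exists2 mss, all normal_arms mss &
    isub (forest lss) (forest mss) /\ isub (forest mss) (forest lss).
  elim: lss hp {GL LG} => [|ls lss IH] /=; first by exists [::] => //; split; apply: isub_refl.
  case/andP=> /normal_armsP[ls' n1 [h1 h1']] /IH[mss n2 [h2 h2']].
  by exists (ls' :: mss) => /=; rewrite ?n1 //; split; apply: gunion_mono.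
pose ns := sort head_geq [seq c <- mss | c != [::]].
pose a := count (predC (fun c : seq nat => c != [::])) mss.
have pm : perm_eq (ns ++ nseq a [::]) mss.
  apply: (@perm_trans _ _ _ _ _ (permEl (perm_filterC (fun c => c != [::]) mss))).
  apply: perm_cat; first by rewrite perm_sort.
  rewrite /a -size_filter; set s := filter _ _.
  suff /all_pred1P <- : all (pred1 [::]) s by [].
  by rewrite all_filter; apply/allP=> c _ /=; rewrite negbK; apply/implyP.
exists ns, a; split.
- rewrite /normal_components !all_sort filter_all sort_sorted ?andbT; last first.
    by move=> c d; rewrite /head_geq leq_total.
  by apply/allP=> c; rewrite mem_filter => /andP[_ /(allP hm)].
- by apply: isub_trans GL (isub_trans LM _); apply: forest_perm; rewrite perm_sym.
apply: isub_trans (isub_trans ML LG); exact: forest_perm.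
Qed.

(** * Embeddings into the unbounded families of stars *)

Lemma arms_le_nseq k t : k <= t -> arms_le (nseq k 1) (nseq t 1).
Proof. by elim: k t => [|k IH] [|t] //= /IH. Qed.

Lemma ones_of_sorted ls : sorted geq (1 :: ls) -> all (leq 1) ls -> ls = nseq (size ls) 1.
Proof.
elim: ls => [|x ls IH] //= /andP[h1 h2] /andP[h3 h4].
have x1 : x = 1 by rewrite /geq /= in h1; lia.
rewrite x1 in h2 *; congr (_ :: _); exact: IH.
Qed.

Lemma P1_forest : isub (forest [:: [::]]) (P 1).
Proof. isub_compute. Qed.

Lemma forest_copies_P1 t : isub (forest (nseq t [::])) (copies t (P 1)).
Proof.
elim: t => [|t IH]; first exact: isub_refl.
apply: gunion_mono IH; isub_compute.
Qed.

Lemma forest_P1s_P3 t :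
  isub (forest ([:: 1; 1] :: nseq t [::])) (gunion (copies t (P 1)) (P 3)).
Proof.
apply: isub_trans (gunion_comm _ _); apply: gunion_mono (forest_copies_P1 t).
isub_compute.
Qed.

Lemma forest_star_P1 t : isub (forest [:: nseq t 1; [::]]) (gunion (star t) (P 1)).
Proof. by apply: gunion_mono P1_forest; apply: isub_refl. Qed.

Lemma forest_starpp_P1 t :
  isub (forest [:: 3 :: nseq t 1; [::]]) (gunion (starpp t.+1) (P 1)).
Proof. by apply: gunion_mono P1_forest; apply: isub_refl. Qed.

Lemma forest_starp t : isub (forest [:: 2 :: nseq t 1]) (starp t.+1).
Proof. exact: gunion0_isub. Qed.

Lemma nth_nseq1 k i p : p < nth 0 (nseq k 1) i -> i < k /\ p = 0.
Proof. by rewrite nth_nseq; case: (ltnP i k) => // ?; lia. Qed.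

(** The isolated vertices go to leaves of the second star, whose centre is left out. *)
Lemma star_P1s_2star k a :
  isub (forest (nseq k 1 :: nseq a [::])) (copies 2 (star (k + a))).
Proof.
apply: (@forest_isub _ [:: nseq (k + a) 1; nseq (k + a) 1]
  (fun x => if x.1 is c.+1 then (1, Some (c, 0)) else x)).
- case=> [[|c] o]; rewrite /coord_valid /= ?size_nseq ?ltnS.
    case: o => [[i p]|] //= /nth_nseq1[hi ->].
    by rewrite nth_nseq ltn_addr.
  by case/andP=> hc _; rewrite nth_nseq ltn_addl.
- case=> [[|c] o] [[|d] o'] //= /andP[/= hc ho] /andP[/= hd ho'] // [e]; rewrite e.
  rewrite !nth_nseq !if_same in ho ho'.
  by case: o ho => [[? ?]|] //=; rewrite ?nth_nil //; case: o' ho' => [[? ?]|] //=; rewrite ?nth_nil.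
case=> [[|c] o] [[|d] o'] //= /andP[/= hc ho] /andP[/= hd ho'] //.
rewrite !nth_nseq !if_same in ho ho'; rewrite /coord_adj /= eqSS.
by case: o ho => [[? ?]|] //=; rewrite ?nth_nil //; case: o' ho' => [[? ?]|] //=; rewrite ?nth_nil.
Qed.

(** Leaving out the vertex next to the centre on the long arm of K_{1,k+1}^{++} separates a star
    with [k] leaves from the P_2 formed by positions 1 and 2 of that arm. *)
Lemma star_P2_P1_starpp k :
  isub (forest [:: nseq k 1; [:: 1]; [::]]) (gunion (starpp k.+1) (P 1)).
Proof.
apply: isub_trans (forest_starpp_P1 k).
apply: (@forest_isub _ _ (fun x => match x with
  | (0, Some (i, p)) => (0, Some (i.+1, p))
  | (0, None) => (0, None)
  | (1, None) => (0, Some (0, 1))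
  | (1, Some _) => (0, Some (0, 2))
  | (_, _) => (1, None) end)).
- by case=> [[|[|[|c]]] [[i p]|]] //=; rewrite /coord_valid //= nth_nil.
- move=> [[|[|[|c]]] o] [[|[|[|d]]] o'] /andP[//= _ h] /andP[//= _ h'];
  case: o h => [[i p]|] //= h; case: o' h' => [[j q]|] //= h' e; rewrite ?nth_nil // in h h';
  try (by case: e => -> ->); have [? ?] := @nth_nseq1 1 _ _ h; have [? ?] := @nth_nseq1 1 _ _ h'.
  by congr (_, Some (_, _)); lia.
move=> [[|[|[|c]]] o] [[|[|[|d]]] o'] /andP[//= _ h] /andP[//= _ h'];
case: o h => [[i p]|] //= h; case: o' h' => [[j q]|] //= h'; rewrite ?nth_nil // in h h' *;
rewrite /coord_adj /= ?andbF //.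
- by have [? ?] := @nth_nseq1 1 _ _ h; have [? ?] := @nth_nseq1 1 _ _ h'; apply/idP/idP; lia.
- by have [? ?] := @nth_nseq1 1 _ _ h; lia.
by have [? ?] := @nth_nseq1 1 _ _ h'; lia.
Qed.

(** * Classification of path star forests *)

Definition above (As : seq graph) (G : graph) : bool := has (fun A => isubb A G) As.
Definition below (Bs : seq graph) (G : graph) : bool := has (isubb G) Bs.
Arguments above : simpl never.
Arguments below : simpl never.

Lemma above_forest s0 lss As G :
  forest_le s0 lss -> above As (forest s0) -> isub (forest lss) G -> above As G.
Proof.
move=> /forest_leP h /(has_nthP gempty)[i hi /isubP hA] hG.
apply/(has_nthP gempty); exists i => //; apply/isubP.
by apply: isub_trans hA (isub_trans h hG).
Qed.

Lemma below_trans Bs G H : isub G H -> below Bs H -> below Bs G.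
Proof.
move=> GH /(has_nthP gempty)[i hi /isubP h].
by apply/(has_nthP gempty); exists i => //; apply/isubP; apply: isub_trans GH h.
Qed.

(** Since a path is written with second arm 1, a second arm of length at least 2 forces a third arm,
    so the last shape always contains S_{1,2,2}. *)
Lemma component_cases c : normal_arms c -> c != [::] ->
  [\/ exists k, c = 1 :: nseq k 1,
      exists x k, c = [:: x.+2, 1 & nseq k 1] |
      exists x y z r, [/\ c = [:: x.+2, y.+2, z.+1 & r], y <= x & z = 0 -> r = nseq (size r) 1]].
Proof.
case: c => [|[|[|x]] c] //.
- by rewrite /normal_arms andbF.
- move=> /and3P[hs /= hp _] _; apply: Or31; exists (size c); congr (_ :: _).
  exact: ones_of_sorted hs hp.
case: c => [|[|[|y]] c] //.
- by rewrite /normal_arms /= !andbF.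
- move=> /and3P[/path_sorted hs /= hp _] _; apply: Or32; exists x, (size c); do 2!congr (_ :: _).
  exact: ones_of_sorted hs hp.
case: c => [|[|z] c] /and3P[hs] //= hp _ _.
apply: Or33; exists x, y, z, c; split=> //; first by case/andP: hs.
by move=> z0; subst z; apply: ones_of_sorted hp; apply: path_sorted (path_sorted hs).
Qed.

Lemma normal_arms_cons c : normal_arms c -> c != [::] -> exists x r, c = x.+1 :: r.
Proof.
case: c => [|[|x] r] //; last by exists x, r.
by rewrite /normal_arms /= andbF.
Qed.

(** Three components with an edge already contain 3P_2, which settles every classification below, so
    larger numbers of components need no distinction. *)
Lemma normal_components_cases (ns : seq (seq nat)) : normal_components ns ->
  [\/ ns = [::],
      exists2 c, ns = [:: c] & normal_arms c /\ c != [::],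
      exists c d, [/\ ns = [:: c; d], normal_arms c /\ c != [::],
                      normal_arms d /\ d != [::] & head 0 d <= head 0 c] |
      exists x r y s z t ns', ns = [:: x.+1 :: r, y.+1 :: s, z.+1 :: t & ns']].
Proof.
move=> /andP[/andP[]]; case: ns => [|c [|d [|e ns]]] /=; rewrite ?andbT.
- by move=> *; apply: Or41.
- by move=> *; apply: Or42; exists c.
- by move=> /andP[? ?] /andP[? ?] ?; apply: Or43; exists c, d.
move=> /and4P[c1 d1 e1 _] /and4P[c2 d2 e2 _] _.
have [x [r ->]] := normal_arms_cons c1 c2; have [y [s ->]] := normal_arms_cons d1 d2.
have [z [t ->]] := normal_arms_cons e1 e2; apply: Or44; by exists x, r, y, s, z, t, ns.
Qed.

Lemma forest_le_refl s : forest_le s s.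
Proof.
elim: s => //= c s ->; rewrite andbT; by elim: c => //= x c ->; rewrite leqnn.
Qed.

Lemma twostar_mono t t' : t <= t' -> isub (copies 2 (star t)) (copies 2 (star t')).
Proof.
move=> h; apply: (@forest_leP [:: nseq t 1; nseq t 1] [:: nseq t' 1; nseq t' 1]).
by rewrite /= !arms_le_nseq.
Qed.

Lemma stars_2star k l : isub (forest [:: nseq k 1; nseq l 1]) (copies 2 (star (k + l))).
Proof.
apply: (@forest_leP _ [:: nseq (k + l) 1; nseq (k + l) 1]).
by rewrite /= !arms_le_nseq ?leq_addr ?leq_addl.
Qed.

Lemma P1s_2star a : isub (forest (nseq a [::])) (copies 2 (star a)).
Proof.
case: a => [|a]; first by isub_compute.
apply: isub_trans (star_P1s_2star 0 a) (twostar_mono _); lia.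
Qed.

Lemma P1s_P1s_P3 a : isub (forest (nseq a [::])) (gunion (copies a (P 1)) (P 3)).
Proof.
apply: isub_trans (forest_P1s_P3 a); case: a => [|a]; first by apply: forest_leP.
apply: forest_leP => /=; have := forest_le_refl (nseq a.+1 [::]).
by elim: a => //= a IH /IH.
Qed.

Notation "n *P m" := (copies n (P m)) (at level 39).
Notation "G +u H" := (gunion G H) (at level 50, left associativity).

Definition k_list : seq graph :=
  [:: 2 *P 1 +u 2 *P 2; P 1 +u 2 *P 3; 2 *P 1 +u P 4; 3 *P 2].
Definition l_list : seq graph := [:: starpp 4; P 1 +u 2 *P 2; P 1 +u P 4].
Definition n_list : seq graph := [:: star 3; 3 *P 1 +u P 2; 2 *P 2].
Definition o_list : seq graph := [:: star 3; P 2 +u P 4; 2 *P 3; P 6].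

(* [low s]: the forest is arm by arm above [s], which contains a member of the list. *)
Tactic Notation "low" uconstr(s) :=
  let s0 := constr:(s : seq (seq nat)) in
  left; match goal with h : isub (forest _) _ |- _ =>
    apply: (@above_forest s0 _ _ _ _ _ h); [ by [] | by vm_compute ] end.
Ltac up :=
  match goal with h : isub _ (forest _) |- is_true (below _ _) =>
    by apply: (below_trans h); vm_compute end.
Lemma psf_2P2_free G : path_star_forest G ->
  above [:: 2 *P 2] G \/ exists lss, [/\ isub G (forest lss), isub (forest lss) G &
    [\/ exists a, lss = nseq a [::],
        exists k a, lss = (1 :: nseq k 1) :: nseq a [::] |
        exists k a, lss = [:: 2, 1 & nseq k 1] :: nseq a [::]]].
Proof.
case/psf_normal=> ns [a [/normal_components_cases hn GL LG]].
case: hn GL LG => [->|[c -> [hn h0]]|[c [d [-> [c1 c0] [d1 d0] _]]]|[x [r [y [s [z [t [ns' ->]]]]]]]] GL LG.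
- by right; exists (nseq a [::]); split=> //; apply: Or31; exists a.
- case: (component_cases hn h0) GL LG => [[k ->]|[x [k ->]]|[x [y [z [r [-> _ _]]]]]] GL LG.
  + by right; eexists; split; try eassumption; apply: Or32; exists k, a.
  + case: x GL LG => [|x] GL LG; last by low [:: [:: 3; 1]].
    by right; eexists; split; try eassumption; apply: Or33; exists k, a.
  by low [:: [:: 2; 2; 1]].
- have [x [r e]] := normal_arms_cons c1 c0; have [y [s e']] := normal_arms_cons d1 d0.
  by subst c d; low [:: [:: 1]; [:: 1]].
by low [:: [:: 1]; [:: 1]].
Qed.

Lemma psf_P4_cases G : path_star_forest G -> above [:: 3 *P 1; 2 *P 2] G \/ below [:: P 4] G.
Proof.
case/psf_2P2_free=> [h|[lss [GL LG [[a e]|[k [a e]]|[k [a e]]]]]].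
- by left; apply/orP; right.
- by subst lss; case: a GL LG => [|[|[|a]]] GL LG; first [by right; up | low [:: [::]; [::]; [::]]].
- subst lss; case: k GL LG => [|[|k]] GL LG; last by low [:: [:: 1; 1; 1]].
    case: a GL LG => [|[|a]] GL LG; first [by right; up | low [:: [:: 1]; [::]; [::]]].
  case: a GL LG => [|a] GL LG; first [by right; up | low [:: [:: 1; 1]; [::]]].
subst lss; case: k GL LG => [|k] GL LG; last by low [:: [:: 2; 1; 1]].
case: a GL LG => [|a] GL LG; first [by right; up | low [:: [:: 2; 1]; [::]]].
Qed.

Ltac above_2P2 h := by left; move: h; rewrite /above /= orbF => ->; rewrite ?orbT.

(** Applies to the partner of a graph containing 2P_2, from which (n) excludes [n_list]. *)
Lemma psf_n_cases G : path_star_forest G ->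
  above n_list G \/ below [:: 2 *P 1 +u P 3; P 1 +u P 4] G \/ exists t, isub G (t *P 1).
Proof.
case/psf_2P2_free=> [h|[lss [GL LG [[a e]|[k [a e]]|[k [a e]]]]]]; try subst lss.
- above_2P2 h.
- by right; right; exists a; apply: isub_trans GL (forest_copies_P1 a).
- case: k GL LG => [|[|k]] GL LG; last by low [:: [:: 1; 1; 1]].
    case: a GL LG => [|[|[|a]]] GL LG; first [by right; left; up | low [:: [:: 1]; [::]; [::]; [::]]].
  case: a GL LG => [|[|[|a]]] GL LG; first [by right; left; up | low [:: [:: 1; 1]; [::]; [::]; [::]]].
case: k GL LG => [|k] GL LG; last by low [:: [:: 2; 1; 1]].
case: a GL LG => [|[|a]] GL LG; first [by right; left; up | low [:: [:: 2; 1]; [::]; [::]]].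
Qed.

Lemma psf_claw_2P2_free_cases G : path_star_forest G ->
  above [:: star 3; 2 *P 2; 2 *P 1 +u P 4] G \/ below [:: P 1 +u P 4] G \/
  exists t, isub G (t *P 1 +u P 3).
Proof.
case/psf_2P2_free=> [h|[lss [GL LG [[a e]|[k [a e]]|[k [a e]]]]]]; try subst lss.
- above_2P2 h.
- by right; right; exists a; apply: isub_trans GL (P1s_P1s_P3 a).
- case: k GL LG => [|[|k]] GL LG; last by low [:: [:: 1; 1; 1]].
    right; right; exists a; apply: isub_trans GL (isub_trans (forest_leP _) (forest_P1s_P3 a)).
    exact: forest_le_refl.
  by right; right; exists a; apply: isub_trans GL (forest_P1s_P3 a).
case: k GL LG => [|k] GL LG; last by low [:: [:: 2; 1; 1]].
case: a GL LG => [|[|a]] GL LG; first [by right; left; up | low [:: [:: 2; 1]; [::]; [::]]].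
Qed.

Lemma psf_2P2_4P1_claw_free_cases G : path_star_forest G ->
  above [:: 2 *P 2; 4 *P 1; star 3] G \/ below [:: P 1 +u P 4] G.
Proof.
case/psf_2P2_free=> [h|[lss [GL LG [[a e]|[k [a e]]|[k [a e]]]]]]; try subst lss.
- above_2P2 h.
- by case: a GL LG => [|[|[|[|a]]]] GL LG; first [by right; up | low [:: [::]; [::]; [::]; [::]]].
- case: k GL LG => [|[|k]] GL LG; last by low [:: [:: 1; 1; 1]].
    case: a GL LG => [|[|[|a]]] GL LG; first [by right; up | low [:: [:: 1]; [::]; [::]; [::]]].
  case: a GL LG => [|[|a]] GL LG; first [by right; up | low [:: [:: 1; 1]; [::]; [::]]].
case: k GL LG => [|k] GL LG; last by low [:: [:: 2; 1; 1]].
case: a GL LG => [|[|a]] GL LG; first [by right; up | low [:: [:: 2; 1]; [::]; [::]]].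
Qed.

Lemma psf_2P2_codiamond_free_cases G : path_star_forest G ->
  above [:: 2 *P 2; 2 *P 1 +u P 2] G \/ below [:: P 4] G \/
  (exists t, isub G (t *P 1)) \/ exists t, isub G (star t.+1 +u P 1).
Proof.
case/psf_2P2_free=> [h|[lss [GL LG [[a e]|[k [a e]]|[k [a e]]]]]]; try subst lss.
- above_2P2 h.
- by right; right; left; exists a; apply: isub_trans GL (forest_copies_P1 a).
- case: a GL LG => [|[|a]] GL LG; last by low [:: [:: 1]; [::]; [::]].
    right; right; right; exists k; apply: isub_trans GL (isub_trans (forest_leP _) (forest_star_P1 k.+1)).
    by rewrite /= arms_le_nseq.
  by right; right; right; exists k; apply: isub_trans GL (forest_star_P1 k.+1).
case: k GL LG => [|k] GL LG; last by low [:: [:: 2; 1; 1]].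
case: a GL LG => [|a] GL LG; first [by right; left; up | low [:: [:: 2; 1]; [::]]].
Qed.

Lemma psf_2P2_codiamond_claw_free_cases G : path_star_forest G ->
  above [:: 2 *P 2; 2 *P 1 +u P 2; star 3] G \/ below [:: P 4; P 1 +u P 3] G \/
  exists t, isub G (t *P 1).
Proof.
case/psf_2P2_free=> [h|[lss [GL LG [[a e]|[k [a e]]|[k [a e]]]]]]; try subst lss.
- above_2P2 h.
- by right; right; exists a; apply: isub_trans GL (forest_copies_P1 a).
- case: a GL LG => [|[|a]] GL LG; last by low [:: [:: 1]; [::]; [::]].
    case: k GL LG => [|[|k]] GL LG; first [by right; left; up | low [:: [:: 1; 1; 1]]].
  case: k GL LG => [|[|k]] GL LG; first [by right; left; up | low [:: [:: 1; 1; 1]]].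
case: k GL LG => [|k] GL LG; last by low [:: [:: 2; 1; 1]].
case: a GL LG => [|a] GL LG; first [by right; left; up | low [:: [:: 2; 1]; [::]]].
Qed.

(** The bounds are those of (d), plus [S 1 1 3] from the open pair with K_4. *)
Lemma psf_l_cases G : path_star_forest G ->
  above l_list G \/ below [:: P 5; S 1 1 3] G \/
  (exists t, isub G (copies 2 (star t))) \/ exists t, isub G (starp t.+1).
Proof.
case/psf_normal=> ns [a [/normal_components_cases hn GL LG]].
case: hn GL LG => [->|[c -> [hn h0]]|[c [d [-> [c1 c0] [d1 d0] cd]]]|[x [r [y [s [z [t [ns' ->]]]]]]]] GL LG.
- by right; right; left; exists a; apply: isub_trans GL (P1s_2star a).
- case: (component_cases hn h0) GL LG => [[k ->]|[x [k ->]]|[x [y [z [r [-> _ _]]]]]] GL LG.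
  + by right; right; left; eexists; apply: isub_trans GL (star_P1s_2star k.+1 a).
  + case: a GL LG => [|a] GL LG; last by low [:: [:: 2; 1]; [::]].
    case: x GL LG => [|[|x]] GL LG; last by low [:: [:: 4; 1]].
      by right; right; right; exists k.+1; apply: isub_trans GL (forest_starp k.+1).
    by case: k GL LG => [|[|k]] GL LG; first [by right; left; up | low [:: [:: 3; 1; 1; 1]]].
  by low [:: [:: 2; 2; 1]].
- have [y [s e']] := normal_arms_cons d1 d0.
  case: a GL LG => [|a] GL LG; last first.
    by have [x [r e]] := normal_arms_cons c1 c0; subst c d; low [:: [:: 1]; [:: 1]; [::]].
  case: (component_cases c1 c0) GL LG cd => [[k ->]|[x [k ->]]|[x [? [? [r [-> _ _]]]]]] GL LG cd.
  + case: (component_cases d1 d0) GL LG cd => [[l ->]|[? [? ->]]|[? [? [? [? [-> _ _]]]]]] GL LG // _.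
    by right; right; left; eexists; apply: isub_trans GL (stars_2star k.+1 l.+1).
  + by subst d; low [:: [:: 2; 1]; [:: 1]].
  by subst d; low [:: [:: 2; 1]; [:: 1]].
by low [:: [:: 1]; [:: 1]; [:: 1]].
Qed.

(** Both lists are excluded when the partner contains 2P_1+P_2 and 3P_1. The two finite bounds are
    the partners of the diamond in the open pairs. *)
Lemma psf_o_cases G : path_star_forest G ->
  above (o_list ++ k_list) G \/ below [:: P 1 +u (P 2 +u P 3); P 1 +u P 5] G \/
  exists t, isub G (t *P 1 +u P 3).
Proof.
case/psf_normal=> ns [a [/normal_components_cases hn GL LG]].
case: hn GL LG => [->|[c -> [hn h0]]|[c [d [-> [c1 c0] [d1 d0] cd]]]|[x [r [y [s [z [t [ns' ->]]]]]]]] GL LG.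
- by right; right; exists a; apply: isub_trans GL (P1s_P1s_P3 a).
- case: (component_cases hn h0) GL LG => [[k ->]|[x [k ->]]|[x [y [z [r [-> _ _]]]]]] GL LG.
  + case: k GL LG => [|[|k]] GL LG; last by low [:: [:: 1; 1; 1]].
      right; right; exists a; apply: isub_trans GL (isub_trans (forest_leP _) (forest_P1s_P3 a)).
      exact: forest_le_refl.
    by right; right; exists a; apply: isub_trans GL (forest_P1s_P3 a).
  + case: k GL LG => [|k] GL LG; last by low [:: [:: 2; 1; 1]].
    case: x GL LG => [|[|x]] GL LG; last by low [:: [:: 4; 1]].
      by case: a GL LG => [|[|a]] GL LG; first [by right; left; up | low [:: [:: 2; 1]; [::]; [::]]].
    by case: a GL LG => [|[|a]] GL LG; first [by right; left; up | low [:: [:: 2; 1]; [::]; [::]]].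
  by low [:: [:: 2; 2; 1]].
- have [y [s e']] := normal_arms_cons d1 d0.
  case: a GL LG => [|[|a]] GL LG; last first.
  + by have [x [r e]] := normal_arms_cons c1 c0; subst c d; low [:: [:: 1]; [:: 1]; [::]; [::]].
  + case: (component_cases c1 c0) GL LG cd => [[k ->]|[x [k ->]]|[x [? [? [r [-> _ _]]]]]] GL LG cd.
    * case: (component_cases d1 d0) GL LG cd => [[l ->]|[? [? ->]]|[? [? [? [? [-> _ _]]]]]] GL LG // _.
      case: k l GL LG => [|[|k]] [|[|l]] GL LG;
        first [by right; left; up | low [:: [:: 1; 1; 1]] | low [:: [:: 1; 1]; [:: 1; 1]] | low [:: [:: 1]; [:: 1; 1; 1]]].
    * by subst d; low [:: [:: 2; 1]; [:: 1]].
    by subst d; low [:: [:: 2; 1]; [:: 1]].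
  case: (component_cases c1 c0) GL LG cd => [[k ->]|[x [k ->]]|[x [? [? [r [-> _ _]]]]]] GL LG cd.
  + case: (component_cases d1 d0) GL LG cd => [[l ->]|[? [? ->]]|[? [? [? [? [-> _ _]]]]]] GL LG // _.
    case: k l GL LG => [|[|k]] [|[|l]] GL LG;
        first [by right; left; up | low [:: [:: 1; 1; 1]] | low [:: [:: 1; 1]; [:: 1; 1]] | low [:: [:: 1]; [:: 1; 1; 1]]].
  + by subst d; low [:: [:: 2; 1]; [:: 1]].
  by subst d; low [:: [:: 2; 1]; [:: 1]].
by low [:: [:: 1]; [:: 1]; [:: 1]].
Qed.

(** Every bound except P_7 and S_{1,2,3} falls under (d) or (e); these two are the partners of K_3
    in the open pairs. *)
Lemma psf_k_cases G : path_star_forest G ->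
  above k_list G \/ below [:: P 7; S 1 2 3; P 2 +u P 4] G \/
  (exists t, isub G (copies 2 (star t))) \/ exists t, isub G (starpp t.+1 +u P 1).
Proof.
case/psf_normal=> ns [a [/normal_components_cases hn GL LG]].
case: hn GL LG => [->|[c -> [hn h0]]|[c [d [-> [c1 c0] [d1 d0] cd]]]|[x [r [y [s [z [t [ns' ->]]]]]]]] GL LG.
- by right; right; left; exists a; apply: isub_trans GL (P1s_2star a).
- case: (component_cases hn h0) GL LG => [[k ->]|[x [k ->]]|[x [y [z [r [-> xy hr]]]]]] GL LG.
  + by right; right; left; eexists; apply: isub_trans GL (star_P1s_2star k.+1 a).
  + case: (ltnP 1 x) => hx.
      case: x hx GL LG => [|[|x]] // _ GL LG.
      case: k GL LG => [|k] GL LG; last by low [:: [:: 4; 1; 1]].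
      case: a GL LG => [|a] GL LG; last by low [:: [:: 4; 1]; [::]].
      by case: x GL LG => [|[|x]] GL LG; first [by right; left; up | low [:: [:: 6; 1]]].
    case: a GL LG => [|[|a]] GL LG; last by low [:: [:: 2; 1]; [::]; [::]].
      right; right; right; exists k.+1.
      apply: isub_trans GL (isub_trans (forest_leP _) (forest_starpp_P1 k.+1)).
      by rewrite /= !ltnS hx arms_le_nseq.
    right; right; right; exists k.+1.
    apply: isub_trans GL (isub_trans (forest_leP _) (forest_starpp_P1 k.+1)).
    by rewrite /= !ltnS hx arms_le_nseq.
  case: y xy GL LG => [|y] xy GL LG; last by case: x xy GL LG => // x _ GL LG; low [:: [:: 3; 3; 1]].
  case: z hr GL LG => [|z] hr GL LG; last by low [:: [:: 2; 2; 2]].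
  case: r hr GL LG => [|[|r1] r] hr GL LG.
  + case: a GL LG => [|a] GL LG; last by low [:: [:: 2; 2; 1]; [::]].
    by case: x {xy} GL LG => [|[|x]] GL LG; first [by right; left; up | low [:: [:: 4; 2; 1]]].
  + by have := hr erefl.
  by low [:: [:: 2; 2; 1; 1]].
- have [y [s e']] := normal_arms_cons d1 d0.
  case: (component_cases c1 c0) GL LG cd => [[k ->]|[x [k ->]]|[x [? [? [r [-> _ _]]]]]] GL LG cd; last first.
  + by subst d; case: s {d1 d0 cd} GL LG => [|s1 s] GL LG; low [:: [:: 2; 2; 1]; [:: 1]].
  + subst d; case: s d1 {d0 cd} GL LG => [|[|s1] s] d1 GL LG.
    * case: a GL LG => [|a] GL LG; last by low [:: [:: 2; 1]; [:: 1]; [::]].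
      case: x GL LG => [|x] GL LG; last by low [:: [:: 3; 1]; [:: 1]].
      case: k GL LG => [|k] GL LG; last by low [:: [:: 2; 1; 1]; [:: 1]].
      case: y d1 GL LG => [|y] d1 GL LG; last by case/and3P: d1.
      by right; left; up.
    * by case/and3P: d1.
    by low [:: [:: 2; 1]; [:: 1; 1]].
  case: (component_cases d1 d0) GL LG cd => [[l ->]|[? [? ->]]|[? [? [? [? [-> _ _]]]]]] GL LG // _.
  case: a GL LG => [|[|a]] GL LG; last by low [:: [:: 1]; [:: 1]; [::]; [::]].
    by right; right; left; eexists; apply: isub_trans GL (stars_2star k.+1 l.+1).
  case: l GL LG => [|l] GL LG.
    by right; right; right; eexists; apply: isub_trans GL (star_P2_P1_starpp k.+1).
  case: k GL LG => [|k] GL LG; last by low [:: [:: 1; 1]; [:: 1; 1]; [::]].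
  (* Two stars tie in the order on longest arms, so here the P_2 precedes the larger star and the
     components are permuted. *)
  right; right; right; eexists; apply: isub_trans GL (isub_trans _ (star_P2_P1_starpp l.+2)).
  apply: forest_perm; exact: (@permEl _ (_ ++ _) (_ ++ _) (perm_catCA [:: [:: 1]] [:: nseq l.+2 1] [:: [::]])).
by low [:: [:: 1]; [:: 1]; [:: 1]].
Qed.

(** * Graphs that do not embed in forests or in the unbounded families *)

Definition parent (x : coord) : coord :=
  match x with
  | (c, Some (k, p.+1)) => (c, Some (k, p))
  | (c, _) => (c, None)
  end.
Definition depth (x : coord) : nat := if x.2 is Some (_, p) then p.+1 else 0.

(** Each component is rooted at its centre; every edge then joins a vertex to its parent, one level
    up. *)
Lemma coord_adj_parent x y : coord_adj x y ->
  (depth x = (depth y).+1 /\ parent x = y) \/ (depth y = (depth x).+1 /\ parent y = x).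
Proof.
case: x y => [c o] [d o'] /andP[/= /eqP<-].
case: o o' => [[k p]|] [[l q]|] //=.
- by case/andP=> [/eqP<- /orP[]/eqP->]; [right|left].
- by move/eqP=> ->; left.
by move/eqP=> ->; right.
Qed.

Lemma isub_forest_coord X lss : isub X (forest lss) ->
  exists g : nat -> coord,
  [/\ forall i, i < nv X -> coord_valid lss (g i),
      forall i j, i < nv X -> j < nv X -> g i = g j -> i = j &
      forall i j, i < nv X -> j < nv X -> coord_adj (g i) (g j) = nadj X i j].
Proof.
case/isub_nat=> f [fB fI fA]; exists (fun i => tocoord lss (f i)); split=> [i hi|i j hi hj e|i j hi hj].
- by apply/tocoord_valid/fB.
- by apply: fI => //; rewrite -(tocoordK lss (f i)) e tocoordK.
by rewrite -nadj_forest ?fA // fB.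
Qed.

(** Three depths cannot pairwise differ by exactly one. *)
Lemma forest_K3_free lss : ~ isub (K 3) (forest lss).
Proof.
case/isub_forest_coord=> g [_ gI gA].
have h01 : coord_adj (g 0) (g 1) by rewrite gA.
have h12 : coord_adj (g 1) (g 2) by rewrite gA.
have h02 : coord_adj (g 0) (g 2) by rewrite gA.
move: (coord_adj_parent h01) (coord_adj_parent h12) (coord_adj_parent h02); lia.
Qed.

(** A deepest vertex of the cycle would have both neighbours as its parent, so two opposite vertices
    would coincide. *)
Lemma forest_C4_free lss : ~ isub (C 4) (forest lss).
Proof.
case/isub_forest_coord=> g [_ gI gA].
have h01 : coord_adj (g 0) (g 1) by rewrite gA.
have h12 : coord_adj (g 1) (g 2) by rewrite gA.
have h23 : coord_adj (g 2) (g 3) by rewrite gA.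
have h03 : coord_adj (g 0) (g 3) by rewrite gA.
have n02 : g 0 <> g 2 by move/gI => /(_ isT isT).
have n13 : g 1 <> g 3 by move/gI => /(_ isT isT).
case: (coord_adj_parent h01) (coord_adj_parent h12) (coord_adj_parent h23) (coord_adj_parent h03)
  => [[d1 e1]|[d1 e1]] [[d2 e2]|[d2 e2]] [[d3 e3]|[d3 e3]] [[d4 e4]|[d4 e4]]; try lia;
  by [case: n02; congruence | case: n13; congruence].
Qed.

Lemma star_P1_forest t : isub (star t +u P 1) (forest [:: nseq t 1; [::]]).
Proof. by apply: gunion_mono (isub_refl _) _; isub_compute. Qed.

Lemma starpp_P1_forest t : isub (starpp t +u P 1) (forest [:: 3 :: nseq t.-1 1; [::]]).
Proof. by apply: gunion_mono (isub_refl _) _; isub_compute. Qed.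

Lemma P1s_P3_forest t : isub (t *P 1 +u P 3) (forest ([:: 1; 1] :: nseq t [::])).
Proof.
apply: isub_trans (gunion_comm _ _) _; apply: gunion_mono; first by isub_compute.
elim: t => [|t IH]; first exact: isub_refl.
by apply: gunion_mono IH; isub_compute.
Qed.

(** The centre of the first component covers every edge. Two disjoint edges or a triangle would need
    two covering vertices, which refutes the families of (b) and (c). *)
Definition one_star (lss : seq (seq nat)) : Prop :=
  forall x y, coord_valid lss x -> coord_valid lss y -> coord_adj x y -> x = (0, None) \/ y = (0, None).

Lemma one_star_free lss X : one_star lss -> isub X (forest lss) -> ~ isub (2 *P 2) X /\ ~ isub (K 3) X.
Proof.
move=> hub XL; split=> h.
  have [g [gV gI gA]] := isub_forest_coord (isub_trans h XL).
  have e i j : i < 4 -> j < 4 -> nadj (2 *P 2) i j -> g i = (0, None) \/ g j = (0, None).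
    by move=> hi hj a; apply: hub; rewrite ?gV ?gA.
  have [] := e 0 1 isT isT isT; have [] := e 2 3 isT isT isT => <- /gI; by move/(_ isT isT).
have [g [gV gI gA]] := isub_forest_coord (isub_trans h XL).
have e i j : i < 3 -> j < 3 -> nadj (K 3) i j -> g i = (0, None) \/ g j = (0, None).
  by move=> hi hj a; apply: hub; rewrite ?gV ?gA.
have [] := e 0 1 isT isT isT => h1.
  have [] := e 1 2 isT isT isT; rewrite -h1 => /gI; by move/(_ isT isT).
have [] := e 0 2 isT isT isT; rewrite -h1 => /gI; by move/(_ isT isT).
Qed.

Lemma star_P1_free t X : isub X (star t +u P 1) -> ~ isub (2 *P 2) X /\ ~ isub (K 3) X.
Proof.
move=> h; apply: one_star_free (isub_trans h (star_P1_forest t)).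
move=> [c o] [d o'] /andP[/= hc ho] /andP[/= hd ho'] /andP[/= /eqP e]; rewrite -{}e in ho' *.
case: c hc ho ho' {hd} => [|[|//]] _ /= ho ho'; last first.
  by case: o ho => [[? ?]|]; case: o' ho' => [[? ?]|] //=; rewrite nth_nil.
case: o ho => [[i u]|] /= ho; last by left.
case: o' ho' => [[j v]|] /= ho'; last by right.
have [_ ->] := nth_nseq1 ho; have [_ ->] := nth_nseq1 ho'; by rewrite andbF.
Qed.

Lemma P1s_P3_free t X : isub X (t *P 1 +u P 3) -> ~ isub (2 *P 2) X /\ ~ isub (K 3) X.
Proof.
move=> h; apply: one_star_free (isub_trans h (P1s_P3_forest t)).
move=> [c o] [d o'] /andP[/= hc ho] /andP[/= hd ho'] /andP[/= /eqP e]; rewrite -{}e in ho' *.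
case: c hc ho ho' {hd} => [|c] _ /= ho ho'; last first.
  rewrite !nth_nseq !if_same in ho ho'.
  by case: o ho => [[? ?]|]; case: o' ho' => [[? ?]|] //=; rewrite nth_nil.
case: o ho => [[i u]|] /= ho; last by left.
case: o' ho' => [[j v]|] /= ho'; last by right.
have [_ ->] := @nth_nseq1 2 _ _ ho; have [_ ->] := @nth_nseq1 2 _ _ ho'; by rewrite andbF.
Qed.

Lemma K_2P1_free t X : isub X (K t) -> ~ isub (2 *P 1) X.
Proof.
move=> h h'; have /isub_nat[f [fB fI fA]] := isub_trans h' h.
have := fA 0 1 isT isT; rewrite /nadj /= andbT => /negbFE/eqP/fI; by move/(_ isT isT).
Qed.

(** Every edge contains the centre of its star. The middle edge of P_4 makes vertex 1 or 2 a centre,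
    and the end edge avoiding that vertex yields a second centre in the same component. *)
Lemma twostar_P4_free t : ~ isub (P 4) (copies 2 (star t)).
Proof.
move=> h; have [g [gV gI gA]] := @isub_forest_coord (P 4) [:: nseq t 1; nseq t 1] h.
have e i j : i < 4 -> j < 4 -> nadj (P 4) i j ->
    (g i).1 = (g j).1 /\ ((g i).2 = None \/ (g j).2 = None).
  move=> hi hj a; have := gV _ hi; have := gV _ hj; have : coord_adj (g i) (g j) by rewrite gA.
  case: (g i) (g j) => [c o] [d o'] /andP[/= /eqP<- ad] /andP[/= hd ho'] /andP[/= _ ho]; split=> //.
  have {hd}ec : nth [::] [:: nseq t 1; nseq t 1] c = nseq t 1 by case: c hd {ho ho'} => [|[|//]].
  rewrite {}ec in ho ho'; case: o ho ad => [[i' u]|]; last by left.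
  case: o' ho' => [[j' v]|] //= ho' ho; last by right.
  have [_ ->] := nth_nseq1 ho; have [_ ->] := nth_nseq1 ho'; by rewrite andbF.
have ext i j : (g i).1 = (g j).1 -> (g i).2 = None -> (g j).2 = None -> g i = g j.
  by case: (g i) (g j) => [? ?] [? ?] /= -> -> ->.
have [c01 e01] := e 0 1 isT isT isT; have [c12 e12] := e 1 2 isT isT isT; have [c23 e23] := e 2 3 isT isT isT.
case: e12 => h1.
  case: e23 => h2; first (have /gI := ext 1 2 c12 h1 h2; by move/(_ isT isT)).
  have /gI := ext 1 3 (etrans c12 c23) h1 h2; by move/(_ isT isT).
case: e01 => h2; first (have /gI := ext 0 2 (etrans c01 c12) h2 h1; by move/(_ isT isT)).
have /gI := ext 1 2 c12 h2 h1; by move/(_ isT isT).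
Qed.

(** The centre and its neighbour on the long arm cover all edges, so two disjoint edges use one of
    them each; but these two vertices are adjacent. *)
Lemma starp_2P2_free t : ~ isub (2 *P 2) (starp t).
Proof.
move=> h; have h' : isub (2 *P 2) (forest [:: 2 :: nseq t.-1 1]) := isub_trans h (isub_gunion0 _).
have [g [gV gI gA]] := isub_forest_coord h'.
have e i j : i < 4 -> j < 4 -> nadj (2 *P 2) i j ->
    [\/ g i = (0, None), g j = (0, None), g i = (0, Some (0, 0)) | g j = (0, Some (0, 0))].
  move=> hi hj a; have := gV _ hi; have := gV _ hj; have : coord_adj (g i) (g j) by rewrite gA.
  case: (g i) (g j) => [c o] [d o'] /andP[/= /eqP<- ad] /andP[/= hd ho'] /andP[/= _ ho].
  case: c hd ho ho' => // _ /=; case: o ad => [[[|i'] u]|]; last by move=> *; apply: Or41.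
    case: u => [|u]; first by move=> *; apply: Or43.
    case: o' => [[[|j'] v]|] //=; case: u => [|u] //; rewrite ?andbF //.
    by case: v => [|[|v]] //= _ _ _; apply: Or44.
  case: o' => [[[|j'] v]|] /=; last by move=> *; apply: Or42.
    by [].
  by case/andP=> _ uv /nth_nseq1[_ u0] /nth_nseq1[_ v0]; subst u v.
have far i j : i < 4 -> j < 4 -> ~~ nadj (2 *P 2) i j -> i != j -> g i = (0, None) \/ g i = (0, Some (0, 0)) ->
    g j = (0, None) \/ g j = (0, Some (0, 0)) -> False.
  move=> hi hj na /eqP nij; have := gA _ _ hi hj; rewrite (negbTE na).
  by move=> + [] ei [] ej; rewrite ei ej //= => _; apply: nij; apply: gI; rewrite ?ei ?ej.
have [i [hi ei]] : exists i, i < 2 /\ (g i = (0, None) \/ g i = (0, Some (0, 0))).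
  by case: (e 0 1 isT isT isT) => h1; [exists 0|exists 1|exists 0|exists 1]; split=> //; tauto.
have [j [hj ej]] : exists j, j < 2 /\ (g j.+2 = (0, None) \/ g j.+2 = (0, Some (0, 0))).
  by case: (e 2 3 isT isT isT) => h1; [exists 0|exists 1|exists 0|exists 1]; split=> //; tauto.
by case: i j hi hj ei ej => [|[|//]] [|[|//]] _ _ ei ej; apply: far ei ej.
Qed.

(* The centre and the middle vertex of the long arm cover all edges, so there
   are no three disjoint edges. *)
Lemma starpp_P1_three_edges t X : isub X (starpp t +u P 1) ->
  ~ [&& 5 < nv X, nadj X 0 1, nadj X 2 3 & nadj X 4 5].
Proof.
move=> h /and4P[h5 a01 a23 a45].
have [g [gV gI gA]] := isub_forest_coord (isub_trans h (starpp_P1_forest t)).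
pose A i := g i = (0, None); pose B i := g i = (0, Some (0, 1)).
have e i j : i < 6 -> j < 6 -> nadj X i j -> (A i \/ A j) \/ (B i \/ B j).
  move=> hi hj a; have hi' : i < nv X by lia.
  have hj' : j < nv X by lia.
  have := gV _ hi'; have := gV _ hj'; have : coord_adj (g i) (g j) by rewrite gA.
  rewrite /A /B; case: (g i) (g j) => [c o] [d o'] /andP[/= /eqP<- ad] /andP[/= hd ho'] /andP[/= _ ho].
  case: c hd ho ho' => [|[|//]] _ /=; last first.
    by case: o ad => [[? ?]|]; case: o' => [[? ?]|] //=; rewrite ?nth_nil.
  case: o ad => [[[|i'] u]|]; last by left; left.
    case: o' => [[[|j'] v]|] //=; last by left; right.
    by case: u => [|[|[|u]]] //; case: v => [|[|[|v]]] //=; tauto.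
  case: o' => [[[|j'] v]|] //=; last by left; right.
  by case/andP=> _ uv /nth_nseq1[_ u0] /nth_nseq1[_ v0]; subst u v.
have inA i j : i < 6 -> j < 6 -> i != j -> A i -> A j -> False.
  by move=> hi hj /eqP n a b; apply: n; apply: gI; rewrite ?a ?b //; lia.
have inB i j : i < 6 -> j < 6 -> i != j -> B i -> B j -> False.
  by move=> hi hj /eqP n a b; apply: n; apply: gI; rewrite ?a ?b //; lia.
case: (e 0 1 isT isT a01) (e 2 3 isT isT a23) (e 4 5 isT isT a45) => [[]a|[]a] [[]b|[]b] [[]c|[]c];
  first [exact: (inA _ _ _ _ _ a b) | exact: (inA _ _ _ _ _ b c) | exact: (inA _ _ _ _ _ a c)
       | exact: (inB _ _ _ _ _ a b) | exact: (inB _ _ _ _ _ b c) | exact: (inB _ _ _ _ _ a c)].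
Qed.

Lemma psf_forest_isub X G : path_star_forest G -> isub X G -> exists lss, isub X (forest lss).
Proof. by case=> lss [_ /iso_isub h] h'; exists lss; apply: isub_trans h' h. Qed.

(** Outside P_4 a path star forest contains 3P_1 or 2P_2, whose complements K_3 and C_4 are cycles
    and lie in no forest. *)
Lemma psf_co_psf_P4 G : path_star_forest G -> path_star_forest (compl G) -> isub G (P 4).
Proof.
move=> pG pC; case: (psf_P4_cases pG) => [|/=]; last by rewrite /below /= orbF => /isubP.
rewrite /above /= orbF => /orP[]/isubP/isub_compl h.
  have {h} : isub (K 3) (compl G) by apply: isub_trans h; isub_compute.
  by case/(psf_forest_isub pC)=> lss /forest_K3_free.
have {h} : isub (C 4) (compl G) by apply: isub_trans h; isub_compute.
by case/(psf_forest_isub pC)=> lss /forest_C4_free.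
Qed.

Lemma copies_P1_mono t t' : t <= t' -> isub (t *P 1) (t' *P 1).
Proof.
move=> /subnK <-; elim: (t' - t) => [|d IH]; first exact: isub_refl.
apply: isub_trans IH _; apply: isub_trans (isub_gunion0 _) (isub_trans _ (gunion_comm _ _)).
by apply: gunion_mono (isub_refl _) _; isub_compute.
Qed.

Lemma star_P1_mono t t' : t <= t' -> isub (star t +u P 1) (star t' +u P 1).
Proof.
move=> h; apply: gunion_mono (isub_refl _); apply/substar_forest/forest_leP.
by rewrite /= arms_le_nseq.
Qed.

Lemma starp_mono t t' : t <= t' -> isub (starp t) (starp t').
Proof.
move=> h; apply/substar_forest/forest_leP; rewrite /= andbT arms_le_nseq //; lia.
Qed.

Definition edgeless (G : graph) : Prop := forall i j, i < nv G -> j < nv G -> nadj G i j = false.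

Lemma nv_copies_P1 t : nv (t *P 1) = t.
Proof. by elim: t => //= t ->. Qed.

Lemma edgeless_copies_P1 t : edgeless (t *P 1).
Proof.
elim: t => [|t IH] i j //=; rewrite nv_copies_P1 => hi hj; rewrite nadj_gunion /=.
case: ltnP => h; first by case: i h hi => // _ _; case: j hj => [|j] //; rewrite /nadj.
case: ltnP => //= h'; apply: IH; rewrite nv_copies_P1; lia.
Qed.

Lemma edgeless_isub F G : edgeless F -> edgeless G -> nv F <= nv G -> isub F G.
Proof.
move=> hF hG le; apply/isub_nat; exists id; split=> //= [i hi|i j hi hj]; first exact: leq_trans hi le.
by rewrite hF // hG // (leq_trans _ le).
Qed.

Lemma isub_copies_P1 F t : isub F (t *P 1) -> isub F (nv F *P 1) /\ isub (nv F *P 1) F.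
Proof.
case/isub_nat=> f [fB fI fA].
have hF : edgeless F by move=> i j hi hj; rewrite -fA // edgeless_copies_P1 // fB.
by split; apply: edgeless_isub => //; rewrite ?nv_copies_P1 //; apply: edgeless_copies_P1.
Qed.

Lemma compl_copies_P1_K t t' : t <= t' -> isub (compl (t *P 1)) (K t').
Proof.
move=> h; apply/isub_nat; exists id; split=> //= [i|i j]; rewrite nv_copies_P1 => hi; first exact: leq_trans hi h.
move=> hj; rewrite nadj_compl edgeless_copies_P1 ?nv_copies_P1 // /nadj /=.
Qed.

Lemma above_cons A As G : above (A :: As) G -> isub A G \/ above As G.
Proof. by case/orP=> [/isubP|]; [left|right]. Qed.

(** * The listed conditions in terms of the complement of the first graph *)

Section ConditionsForests.
Variables F G : graph.
Hypothesis N : ~ cond (compl F) G.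

Lemma not_a : ~ isub F (P 4) /\ ~ isub G (P 4).
Proof.
split=> h; apply: N; left; [left|by right].
by apply: isub_trans (isub_compl h) _; isub_compute.
Qed.

(** The condition wants one common parameter, so the two are merged by their maximum; the same is
    done for (c) and (d). *)
Lemma not_b s t : isub F (star s.+1 +u P 1) -> isub G (star t.+1 +u P 1) -> False.
Proof.
move=> hF hG; apply: N; right; left; exists (maxn s t).+1; split=> //; split.
  by apply: isub_trans (isub_complK _) (isub_trans hF (star_P1_mono _)); lia.
by apply: isub_trans hG (star_P1_mono _); lia.
Qed.

Lemma not_c s t : isub F (s *P 1 +u P 3) -> isub G (t *P 1 +u P 3) -> False.
Proof.
have mono a b : a <= b -> isub (a *P 1 +u P 3) (b *P 1 +u P 3).
  by move=> h; apply: gunion_mono (copies_P1_mono h) (isub_refl _).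
move=> hF hG; apply: N; do 2!right; left; exists (maxn s t).+1; split=> //; split.
  by apply: isub_trans (isub_complK _) (isub_trans hF (mono _ _ _)); lia.
by apply: isub_trans hG (mono _ _ _); lia.
Qed.

Lemma not_d s t : isub F (s *P 1) ->
  [\/ isub G (copies 2 (star t)), isub G (starp t) | isub G (P 5)] -> False.
Proof.
move=> /isub_compl hF hG; apply: N; do 3!right; left; exists (maxn s t).+1; split=> //; split.
  by apply: isub_trans hF (compl_copies_P1_K _); lia.
case: hG => h; [left|right; left|by right; right].
  by apply: isub_trans h (twostar_mono _); lia.
by apply: isub_trans h (starp_mono _); lia.
Qed.

Lemma not_e : isub F (P 1 +u P 3) ->
  [\/ isub G (P 2 +u P 4), isub G (P 6), isub G (S 1 2 2) | exists t, isub G (starpp t.+1 +u P 1)] -> False.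
Proof.
move=> /isub_compl hF hG; apply: N; do 4!right; left; split=> //.
case: hG => [h|h|h|[t h]]; [by left|by right; left|by right; right; left|right; right; right].
by exists t.+1.
Qed.

Lemma not_f : isub F (2 *P 1 +u P 2) -> isub G (P 1 +u 2 *P 2) -> False.
Proof. by move=> /isub_compl hF hG; apply: N; do 5!right; left. Qed.

Lemma not_g : isub F (P 1 +u P 4) -> isub G (P 1 +u P 4) \/ isub G (P 5) -> False.
Proof. by move=> /isub_compl hF hG; apply: N; do 6!right; left. Qed.

Lemma not_h : isub F (2 *P 1 +u P 3) -> isub G (P 2 +u P 3) \/ isub G (P 5) -> False.
Proof. by move=> /isub_compl hF hG; apply: N; do 7!right; left. Qed.

Lemma not_k : isub (3 *P 1) F -> above k_list G -> False.
Proof.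
move=> /isub_compl hF hG; apply: N; do 10!right; left; split.
  by apply: isub_trans hF; isub_compute.
by case/above_cons: hG => [|/above_cons[|/above_cons[|/above_cons[|//]]]]; tauto.
Qed.

Lemma not_l : isub (4 *P 1) F -> above l_list G -> False.
Proof.
move=> /isub_compl hF hG; apply: N; do 11!right; left; split.
  by apply: isub_trans hF; isub_compute.
by case/above_cons: hG => [|/above_cons[|/above_cons[|//]]]; tauto.
Qed.

Lemma not_m : isub (5 *P 1) F -> isub (starpp 3) G -> False.
Proof.
move=> /isub_compl hF hG; apply: N; do 12!right; left; split=> //.
by apply: isub_trans hF; isub_compute.
Qed.

Lemma not_n : isub (2 *P 2) F -> above n_list G -> False.
Proof.
move=> /isub_compl hF hG; apply: N; do 13!right; left; split.
  by apply: isub_trans hF; isub_compute.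
by case/above_cons: hG => [|/above_cons[|/above_cons[|//]]]; tauto.
Qed.

Lemma not_o : isub (2 *P 1 +u P 2) F -> above o_list G -> False.
Proof.
move=> /isub_compl hF hG; apply: N; do 14!right; left; split=> //.
by case/above_cons: hG => [|/above_cons[|/above_cons[|/above_cons[|//]]]]; tauto.
Qed.

Lemma not_p : isub (P 1 +u P 4) F -> isub (P 1 +u 2 *P 2) G -> False.
Proof. by move=> /isub_compl hF hG; apply: N; do 15!right. Qed.

End ConditionsForests.

(** * Pairs satisfying no condition are open *)

Section Forward.
Variable p : graph * graph.
Hypothesis N : forall H3 H4, pair_equiv p (H3, H4) -> ~ cond H3 H4.

(* [F] is the complement of the first graph of the pair: then the pair is
   symmetric in [F] and [G]. *)
Definition linked (F G : graph) : Prop := pair_equiv p (compl F, G).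

Definition is_open : Prop := exists A B, inP (A, B) open_pairs /\ pair_equiv p (A, B).

Lemma pair_equiv_step q r : pair_equiv p q -> pair_step q r -> pair_equiv p r.
Proof. by move=> h s; apply: rt_trans h _; apply: rt_step. Qed.

Lemma linked_sym F G : linked F G -> linked G F.
Proof.
move=> h; apply: pair_equiv_step (ps_swap _ _).
apply: pair_equiv_step (pair_equiv_step h (ps_compl _ _)) (ps_iso _ _).
  exact: iso_complK.
exact: isub_anti_iso (isub_refl _) (isub_refl _).
Qed.

Lemma linked_iso F G F' G' : linked F G -> isub F F' -> isub F' F -> isub G G' -> isub G' G -> linked F' G'.
Proof.
move=> h f f' g g'; apply: pair_equiv_step h (ps_iso _ _); last exact: isub_anti_iso.
by apply/iso_compl/isub_anti_iso.
Qed.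

Lemma linked_open F G A B : linked F G -> inP (A, B) open_pairs ->
  isob (compl F) A -> isub G B -> isub B G -> is_open.
Proof.
move=> h hi /isoP hA g g'; exists A, B; split=> //.
by apply: pair_equiv_step h (ps_iso hA _); apply: isub_anti_iso.
Qed.

(** This is the replacement of the paw by K_3, seen on complements. *)
Lemma linked_P1P3_3P1 G : linked (P 1 +u P 3) G -> linked (3 *P 1) G.
Proof.
move=> h; have h' : pair_equiv p (K 3, G) by apply: pair_equiv_step h (ps_pawK3 _ _); iso_compute.
apply: pair_equiv_step h' (ps_iso _ _); first by iso_compute.
exact: isub_anti_iso (isub_refl _) (isub_refl _).
Qed.

Tactic Notation "proper" constr(h) constr(Cs) :=
  case: (@isub_proper Cs _ _ _ h); [by vm_compute | | ].

(** Condition (a) leaves only P_1+P_3 and 3P_1 for [F], and the first is replaced by the second, so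
    the pair is one with K_3. *)
Lemma open_of_P1P3 F G : linked F G -> path_star_forest G -> isub F (P 1 +u P 3) -> is_open.
Proof.
move=> L pG hF; have [nF _] := not_a (N L).
have {}L : linked (3 *P 1) G.
  proper hF [:: 3 *P 1; P 4] => [hF'|[[|[|//]] _ //= h]].
    by apply: linked_P1P3_3P1; apply: linked_iso L _ _ (isub_refl _) (isub_refl _).
  proper h [:: P 4] => [h'|[[|//] _ //=]].
  exact: linked_iso L _ _ (isub_refl _) (isub_refl _).
have e31 : isub (3 *P 1) (P 1 +u P 3) by isub_compute.
case: (psf_k_cases pG) => [h|[|[[t h]|h]]].
- by case: (not_k (N L) (isub_refl _) h).
- rewrite /below /= orbF => /or3P[]/isubP h.
  (* Deleting a vertex of P_7 leaves P_6, P_1+P_5, P_2+P_4 or 2P_3; the second lies in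
     [starpp 3 +u P 1], the last is [copies 2 (star 2)]. *)
  + proper h [:: P 6; P 2 +u P 4; copies 2 (star 2); starpp 3 +u P 1] => [h'|[[|[|[|[|//]]]] _ /= k]].
    * by apply: (linked_open (A := K 3) L _ _ h h') => //; left.
    * by case: (not_e (N L) e31); apply: Or42.
    * by case: (not_e (N L) e31); apply: Or41.
    * by case: (@not_d _ _ (N L) 3 2 (isub_refl _)); apply: Or31.
    by case: (not_e (N L) e31); apply: Or44; exists 2.
  + proper h [:: P 6; P 2 +u P 4; S 1 2 2; starpp 3 +u P 1] => [h'|[[|[|[|[|//]]]] _ /= k]].
    * by apply: (linked_open (A := K 3) L _ _ h h') => //; right; left.
    * by case: (not_e (N L) e31); apply: Or42.
    * by case: (not_e (N L) e31); apply: Or41.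
    * by case: (not_e (N L) e31); apply: Or43.
    by case: (not_e (N L) e31); apply: Or44; exists 2.
  by case: (not_e (N L) e31); apply: Or41.
- by case: (@not_d _ _ (N L) 3 t (isub_refl _)); apply: Or31.
by case: (not_e (N L) e31); apply: Or44.
Qed.

(** An edgeless [F] is determined by its order: up to 3 vertices it lies in P_1+P_3, and from 4 on
    condition (l) applies. *)
Lemma open_of_copies_P1 F G t : linked F G -> path_star_forest G -> isub F (t *P 1) -> is_open.
Proof.
move=> L pG hF; have [hF1 hF2] := isub_copies_P1 hF.
case: (leqP (nv F) 3) => hn.
  apply: (open_of_P1P3 L) => //; apply: isub_trans hF1 (isub_trans (copies_P1_mono hn) _).
  by isub_compute.
have h4 : isub (4 *P 1) F by apply: isub_trans (copies_P1_mono _) hF2.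
case: (psf_l_cases pG) => [h|[|[[s h]|[s h]]]].
- by case: (not_l (N L) h4 h).
- rewrite /below /= orbF => /orP[]/isubP h; first by case: (@not_d _ _ (N L) t 0 hF); apply: Or33.
  proper h [:: P 5; copies 2 (star 3); starp 3] => [h'|[[|[|[|//]]] _ /= k]].
  (* [S 1 1 3] is K_{1,3}^{++}, so (m) excludes five or more vertices, and exactly four give the
     open pair with K_4. *)
  + case: (leqP (nv F) 4) => hn'; last first.
      case: (not_m (N L)); first by apply: isub_trans (copies_P1_mono hn') hF2.
      by apply: isub_trans h'; isub_compute.
    have {}L : linked (4 *P 1) G.
      apply: linked_iso L _ h4 (isub_refl _) (isub_refl _).
      exact: isub_trans hF1 (copies_P1_mono hn').
    by apply: (linked_open (A := K 4) L _ _ h h') => //; do 2!right; left.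
  + by case: (@not_d _ _ (N L) t 0 hF); apply: Or33.
  + by case: (@not_d _ _ (N L) t 3 hF); apply: Or31.
  by case: (@not_d _ _ (N L) t 3 hF); apply: Or32.
- by case: (@not_d _ _ (N L) t s hF); apply: Or31.
by case: (@not_d _ _ (N L) t s.+1 hF); apply: Or32.
Qed.

Ltac no_2P2 h2 h := by have := isub_trans h2 h; move/isubP; vm_compute.

(** Conditions (o) and (k), read with the complement of [G] as first graph, bound [F]; a branch of
    the descent dies once its bound is 2P_2-free. P_1+P_2+P_3, P_1+P_5 and P_2+P_3 can give open
    pairs, while P_1+2P_2 and subgraphs of P_5 are excluded in each use. *)
Lemma cases_2P2 F G : linked F G -> path_star_forest F -> isub (2 *P 2) F ->
  isub (2 *P 1 +u P 2) G -> isub (3 *P 1) G ->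
  [\/ isub F (P 1 +u (P 2 +u P 3)) /\ isub (P 1 +u (P 2 +u P 3)) F,
      isub F (P 1 +u P 5) /\ isub (P 1 +u P 5) F,
      isub F (P 2 +u P 3) /\ isub (P 2 +u P 3) F \/ isub F (P 1 +u 2 *P 2) /\ isub (P 1 +u 2 *P 2) F |
      isub F (P 5)].
Proof.
move=> /linked_sym L pF h2 hG h3.
have reduce : isub F (P 1 +u 2 *P 2) -> isub F (P 1 +u 2 *P 2) /\ isub (P 1 +u 2 *P 2) F \/ isub F (P 5).
  move=> h; proper h [:: P 5; 2 *P 1 +u P 2] => [h'|[[|[|//]] _ /= k]]; first by left.
    by right.
  no_2P2 h2 k.
case: (psf_o_cases pF) => [|[|[t h]]].
- rewrite /above has_cat => /orP[]h; first by case: (not_o (N L) hG h).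
  by case: (not_k (N L) h3 h).
- rewrite /below /= orbF => /orP[]/isubP h.
  + proper h [:: P 2 +u P 3; P 1 +u 2 *P 2; 2 *P 1 +u P 3; 3 *P 1 +u P 2]
      => [h'|[[|[|[|[|//]]]] _ /= k]].
    * exact: Or41.
    * proper k [:: P 5; P 1 +u P 3; 2 *P 1 +u P 2] => [h'|[[|[|[|//]]] _ /= k']].
      - by apply: Or43; left.
      - exact: Or44.
      - no_2P2 h2 k'.
      no_2P2 h2 k'.
    * by case: (reduce k) => ?; [apply: Or43; right|apply: Or44].
    * no_2P2 h2 k.
    no_2P2 h2 k.
  proper h [:: P 5; P 1 +u P 4; 2 *P 1 +u P 3; P 1 +u 2 *P 2] => [h'|[[|[|[|[|//]]]] _ /= k]].
  + exact: Or42.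
  + exact: Or44.
  + no_2P2 h2 k.
  + no_2P2 h2 k.
  by case: (reduce k) => ?; [apply: Or43; right|apply: Or44].
by case: (P1s_P3_free h).
Qed.

(** By (n), [G] is edgeless or lies in 2P_1+P_3 or P_1+P_4. Apart from the two earlier lemmas,
    2P_1+P_2 yields the diamond pairs, P_1+P_4 the gem pair, and 2P_1+P_3 itself is
    contradictory. *)
Lemma open_of_2P2 F G : linked F G -> path_star_forest F -> path_star_forest G ->
  isub (2 *P 2) F -> is_open.
Proof.
move=> L pF pG h2; have L' := linked_sym L; have [_ nG] := not_a (N L).
have small : isub G (P 1 +u P 3) -> is_open by move=> h; exact: (open_of_P1P3 L').
have diamond_case : isub G (2 *P 1 +u P 2) -> is_open.
  move=> h; proper h [:: P 4; 3 *P 1] => [h'|[[|[|//]] _ //= k]]; last first.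
    by apply: small; apply: isub_trans k _; isub_compute.
  have h'' : isub G (2 *P 1 +u P 3) by apply: isub_trans h _; isub_compute.
  have h3 : isub (3 *P 1) G by apply: isub_trans h'; isub_compute.
  have {}L : linked (2 *P 1 +u P 2) F := linked_iso L' h h' (isub_refl _) (isub_refl _).
  case: (cases_2P2 (linked_sym L') pF h2 h' h3) => [[k k']|[k k']|[[k _]|[k _]]|k].
  - by apply: (linked_open (A := diamond) L _ _ k k') => //; do 3!right; left.
  - by apply: (linked_open (A := diamond) L _ _ k k') => //; do 4!right; left.
  - by case: (not_h (N L') h''); left.
  - by case: (not_f (N L') h k).
  by case: (not_h (N L') h''); right.
case: (psf_n_cases pG) => [h|[|[t h]]].
- by case: (not_n (N L) h2 h).
- rewrite /below /= orbF => /orP[]/isubP h.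
  + proper h [:: P 1 +u P 3; 2 *P 1 +u P 2; 4 *P 1] => [h'|[[|[|[|//]]] _ /= k]].
    * have h4 : isub (4 *P 1) G by apply: isub_trans h'; isub_compute.
      have h3 : isub (3 *P 1) G by apply: isub_trans h'; isub_compute.
      have hd : isub (2 *P 1 +u P 2) G by apply: isub_trans h'; isub_compute.
      have no1 : isub (P 1 +u 2 *P 2) F -> is_open.
        by move=> /isubP k; case: (not_l (N L') h4); rewrite /above /= k orbT.
      case: (cases_2P2 L pF h2 hd h3) => [[k k']|[k k']|[[k _]|[_ k]]|k].
      - by apply: no1; apply: isub_trans k'; isub_compute.
      - by apply: no1; apply: isub_trans k'; isub_compute.
      - by case: (not_h (N L') h); left.
      - exact: no1.
      by case: (not_h (N L') h); right.
    * exact: small.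
    * exact: diamond_case.
    exact: (open_of_copies_P1 (t := 4) L' pF k).
  proper h [:: P 4; P 1 +u P 3; 2 *P 1 +u P 2] => [h'|[[|[|[|//]]] _ //=]].
  have h3 : isub (3 *P 1) G by apply: isub_trans h'; isub_compute.
  have hd : isub (2 *P 1 +u P 2) G by apply: isub_trans h'; isub_compute.
  have no1 : isub (P 1 +u 2 *P 2) F -> is_open by move=> k; case: (not_p (N L') h' k).
  have {}L : linked (P 1 +u P 4) F := linked_iso L' h h' (isub_refl _) (isub_refl _).
  case: (cases_2P2 (linked_sym L') pF h2 hd h3) => [[k k']|[k k']|[[k k']|[_ k]]|k].
  + by apply: no1; apply: isub_trans k'; isub_compute.
  + by apply: no1; apply: isub_trans k'; isub_compute.
  + by apply: (linked_open (A := gem) L _ _ k k') => //; do 5!right; left.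
  + exact: no1.
  by case: (not_g (N L') h); right.
exact: (open_of_copies_P1 L' pF h).
Qed.

(** What remains once every source of an open pair has been treated; it is shown to be
    contradictory. *)
Definition residual F G : Prop :=
  [/\ linked F G, path_star_forest F /\ path_star_forest G,
      ~ isub F (P 1 +u P 3) /\ ~ isub G (P 1 +u P 3),
      (forall t, ~ isub F (t *P 1)) /\ (forall t, ~ isub G (t *P 1)) &
      ~ isub (2 *P 2) F /\ ~ isub (2 *P 2) G].

Lemma residual_sym F G : residual F G -> residual G F.
Proof. by case=> /linked_sym ? [? ?] [? ?] [? ?] [? ?]; split. Qed.

Lemma residual_3P1 F G : residual F G -> isub (3 *P 1) F.
Proof.
case=> L [pF _] _ _ [n2 _]; have [nF _] := not_a (N L).
case: (psf_P4_cases pF); last by rewrite /below /= orbF => /isubP.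
by rewrite /above /= orbF => /orP[]/isubP.
Qed.

(** A claw in [F] keeps 2P_1+P_2 out of [G] by (o), so [G] lies in a star plus P_1. If [F] contained
    2P_1+P_2, then (o) the other way would make [G] claw-free as well and hence too small. So [F]
    also lies in a star plus P_1, against (b). *)
Lemma residual_claw F G : residual F G -> isub (star 3) F -> False.
Proof.
move=> [L [pF pG] [sF sG] [tF tG] [n2F n2G]] hF; have L' := linked_sym L.
have [nF nG] := not_a (N L).
have [t hG] : exists t, isub G (star t.+1 +u P 1).
  case: (psf_2P2_codiamond_free_cases pG) => [|[|[[t]|//]]]; last by move/tG.
    rewrite /above /= orbF => /orP[]/isubP // h.
    by case: (not_o (N L') h); rewrite /above /=; move/isubP: hF => ->.
  by rewrite /below /= orbF => /isubP.
have hd : ~ isub (2 *P 1 +u P 2) F.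
  move=> hd; case: (psf_2P2_codiamond_claw_free_cases pG) => [|[|[s]]]; last exact: tG.
    rewrite /above /= orbF => /or3P[]/isubP // h.
      by case: (not_o (N L') h); rewrite /above /=; move/isubP: hF => ->.
    by case: (not_o (N L) hd); rewrite /above /=; move/isubP: h => ->.
  by rewrite /below /= orbF => /orP[]/isubP.
case: (psf_2P2_codiamond_free_cases pF) => [|[|[[s]|[s h]]]].
- by rewrite /above /= orbF => /orP[]/isubP.
- by rewrite /below /= orbF => /isubP.
- exact: tF.
exact: (not_b (N L) h hG).
Qed.

(** The partner contains 3P_1, so (k) removes 2P_1+P_4; claws and 2P_2 are already excluded. *)
Lemma residual_cases F G : residual F G ->
  isub F (P 1 +u P 4) \/ exists t, isub F (t *P 1 +u P 3).
Proof.
move=> R; have h3 := residual_3P1 (residual_sym R); have nc := residual_claw R.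
case: R => L [pF _] _ _ [n2 _].
case: (psf_claw_2P2_free_cases pF) => [|[|]]; last by right.
  rewrite /above /= orbF => /or3P[]/isubP // /isubP h.
  by case: (not_k (N (linked_sym L)) h3); rewrite /above /= h !orbT.
by rewrite /below /= orbF => /isubP; left.
Qed.

(** If [F] is smaller than P_1+P_4, then (a), (c) or residuality is violated. If [F] is P_1+P_4,
    then (l) keeps 4P_1 out of [G], which thus lies in P_1+P_4 too, against (g). *)
Lemma residual_P1P4_P1sP3 F G t : residual F G -> isub F (P 1 +u P 4) -> isub G (t *P 1 +u P 3) -> False.
Proof.
move=> R hF hG; have nc := residual_claw (residual_sym R).
case: R => L [_ pG] [sF _] _ [_ n2]; have [nF _] := not_a (N L).
proper hF [:: P 4; P 1 +u P 3; 2 *P 1 +u P 2] => [h'|[[|[|[|//]]] _ //= k]]; last first.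
  by apply: (@not_c _ _ (N L) 2 t) hG; apply: isub_trans k _; isub_compute.
case: (psf_2P2_4P1_claw_free_cases pG).
  rewrite /above /= orbF => /or3P[]/isubP // h.
  by case: (not_l (N (linked_sym L)) h); rewrite /above /=; move/isubP: h' => ->; rewrite !orbT.
by rewrite /below /= orbF => /isubP h; apply: (not_g (N L) hF); left.
Qed.

Lemma residual_false F G : ~ residual F G.
Proof.
move=> R; have R' := residual_sym R; have [L _ _ _ _] := R.
case: (residual_cases R) => [hF|[s hF]]; case: (residual_cases R') => [hG|[t hG]].
- by apply: (not_g (N L) hF); left.
- exact: residual_P1P4_P1sP3 R hF hG.
- exact: residual_P1P4_P1sP3 R' hG hF.
exact: (not_c (N L) hF hG).
Qed.

Lemma linked_psf_open F G : linked F G -> path_star_forest F -> path_star_forest G -> is_open.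
Proof.
move=> L pF pG; have L' := linked_sym L.
case: (isubP F (P 1 +u P 3)) => [h|sF]; first exact: (open_of_P1P3 L).
case: (isubP G (P 1 +u P 3)) => [h|sG]; first exact: (open_of_P1P3 L').
case: (isubP (2 *P 2) F) => [h|n2F]; first exact: (open_of_2P2 L).
case: (isubP (2 *P 2) G) => [h|n2G]; first exact: (open_of_2P2 L').
case: (classic (exists t, isub F (t *P 1))) => [[t h]|tF]; first exact: (open_of_copies_P1 L pG h).
case: (classic (exists t, isub G (t *P 1))) => [[t h]|tG]; first exact: (open_of_copies_P1 L' pF h).
by case: (@residual_false F G); split=> //; split=> // t h; [apply: tF|apply: tG]; exists t.
Qed.

End Forward.

Lemma no_cond_open H1 H2 :
  (forall H3 H4, pair_equiv (H1, H2) (H3, H4) -> ~ cond H3 H4) -> is_open (H1, H2).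
Proof.
move=> N; have N0 := N _ _ (rt_refl _ _ _).
have refl_iso G : iso G G := isub_anti_iso (isub_refl G) (isub_refl G).
have p12 : path_star_forest H1 \/ path_star_forest H2.
  by apply: NNPP => h; apply: N0; do 8!right; left; split=> h'; apply: h; [left|right].
have c12 : path_star_forest (compl H1) \/ path_star_forest (compl H2).
  by apply: NNPP => h; apply: N0; do 9!right; left; split=> h'; apply: h; [left|right].
case: p12 => p; case: c12 => c.
- by case: N0; do 2!left; apply: psf_co_psf_P4.
(* (i) and (j) may be answered by different graphs; the complement is then taken of [H2], after a
   swap. *)
- apply: (@linked_psf_open _ N (compl H2) H1) => //.
  apply: pair_equiv_step (rt_step _ _ _ _ (ps_swap _ _)) (ps_iso _ _) => //; exact/iso_sym/iso_complK.
- apply: (@linked_psf_open _ N (compl H1) H2) => //.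
  apply: rt_step; apply: ps_iso => //; exact/iso_sym/iso_complK.
by case: N0; left; right; apply: psf_co_psf_P4.
Qed.

(** * Open pairs satisfy no condition *)

(** Arm lists of the second graphs of the open pairs and of the complements of K_3, the paw, K_4,
    the diamond and the gem. Refuting (i) and (j) only takes a sound test on these. *)
Definition psf_candidates : seq (seq (seq nat)) :=
  [:: [:: [:: 6]]; [:: [:: 1; 2; 3]]; [:: [:: 1; 1; 3]]; [:: [::]; [:: 1]; [:: 2]];
      [:: [::]; [:: 4]]; [:: [:: 1]; [:: 2]]; [:: [::]; [::]; [::]]; [:: [::]; [:: 2]];
      [:: [::]; [::]; [::]; [::]]; [:: [::]; [::]; [:: 1]]; [:: [::]; [:: 3]]].
Definition psfb (G : graph) : bool := has (fun lss => isob G (forest lss)) psf_candidates.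

Lemma psfbP G : psfb G -> path_star_forest G.
Proof.
case/hasP=> lss hl /isoP h; exists lss; split=> //.
have : all (all (all (fun l => 0 < l))) psf_candidates by [].
by move/allP/(_ _ hl).
Qed.

(* A decidable consequence of [cond], enough to refute it on the open pairs. *)
Definition condb (X Y : graph) : bool :=
  [|| isubb X (P 4), isubb Y (P 4),
      [&& ~~ isubb (2 *P 2) Y, ~~ isubb (K 3) Y, ~~ isubb (2 *P 2) (compl X) & ~~ isubb (K 3) (compl X)],
      ~~ isubb (2 *P 1) X && [|| ~~ isubb (P 4) Y, ~~ isubb (2 *P 2) Y | isubb Y (P 5)],
      isubb X paw && [|| isubb Y (P 2 +u P 4), isubb Y (P 6), isubb Y (S 1 2 2)
                       | ~~ isubb (P 7) Y && ~~ isubb (S 1 2 3) Y],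
      isubb X diamond && isubb Y (P 1 +u 2 *P 2),
      isubb X gem && (isubb Y (P 1 +u P 4) || isubb Y (P 5)),
      isubb X (compl (2 *P 1 +u P 3)) && (isubb Y (P 2 +u P 3) || isubb Y (P 5)),
      ~~ psfb X && ~~ psfb Y, ~~ psfb (compl X) && ~~ psfb (compl Y),
      isubb (K 3) X && above k_list Y, isubb (K 4) X && above l_list Y,
      isubb (K 5) X && isubb (starpp 3) Y, isubb (C 4) X && above n_list Y,
      isubb diamond X && above o_list Y | isubb gem X && isubb (P 1 +u 2 *P 2) Y].

Lemma isubbT F G : isub F G -> isubb F G.
Proof. by move/isubP. Qed.

Lemma isubbF F G : ~ isub F G -> ~~ isubb F G.
Proof. by move=> h; apply/isubP. Qed.

Lemma above_nth i As G : i < size As -> isub (nth gempty As i) G -> above As G.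
Proof. by move=> hi /isubP h; apply/(has_nthP gempty); exists i. Qed.

(** The parameter [t] is eliminated as follows: (b) and (c) exclude 2P_2 and K_3 on both sides, (d)
    excludes 2P_1 from [X] and, in its unbounded cases, P_4 or 2P_2 from [Y], and the last family of
    (e) excludes P_7 and S_{1,2,3}. *)
Lemma condP X Y : cond X Y -> condb X Y.
Proof.
rewrite /condb => -[[/isubbT h|/isubbT h]|h]; apply/orP; [by left|by right; apply/orP; left|right].
apply/orP; right.
case: h => [[t [_ [/star_P1_free[a b] /star_P1_free[c d]]]]|h].
  by apply/orP; left; apply/and4P; split; apply: isubbF.
case: h => [[t [_ [/P1s_P3_free[a b] /P1s_P3_free[c d]]]]|h].
  by apply/orP; left; apply/and4P; split; apply: isubbF.
apply/orP; right; case: h => [[t [_ [/K_2P1_free a b]]]|h].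
  apply/orP; left; apply/andP; split; first exact: isubbF.
  case: b => [b|[b|/isubbT b]]; last exact/or3P/Or33.
    apply/orP; left; apply: isubbF => h; exact: twostar_P4_free (isub_trans h b).
  apply/or3P/Or32; apply: isubbF => h; exact: starp_2P2_free (isub_trans h b).
apply/orP; right; case: h => [[/isubbT a b]|h].
  apply/orP; left; apply/andP; split=> //; apply/or4P.
  case: b => [/isubbT b|[/isubbT b|[/isubbT b|[t [_ b]]]]]; [exact: Or41|exact: Or42|exact: Or43|].
  (* In both P_7 and [S 1 2 3] the vertices 0 to 5, as numbered, pair up into the edges 01, 23,
     45. *)
  by apply/Or44/andP; split; apply: isubbF => h; apply: (starpp_P1_three_edges (isub_trans h b)).
apply/orP; right; case: h => [[/isubbT a /isubbT b]|h]; first by apply/orP; left; apply/andP.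
apply/orP; right; case: h => [[/isubbT a b]|h].
  by apply/orP; left; apply/andP; split=> //; apply/orP; case: b => /isubbT b; [left|right].
apply/orP; right; case: h => [[/isubbT a b]|h].
  by apply/orP; left; apply/andP; split=> //; apply/orP; case: b => /isubbT b; [left|right].
have psfN G : ~ path_star_forest G -> ~~ psfb G by move=> n; apply/negP=> /psfbP.
apply/orP; right; case: h => [[/psfN a /psfN b]|h]; first by apply/orP; left; apply/andP.
apply/orP; right; case: h => [[/psfN a /psfN b]|h]; first by apply/orP; left; apply/andP.
apply/orP; right; case: h => [[/isubbT a b]|h].
  apply/orP; left; apply/andP; split=> //.
  by case: b => [|[|[|]]]; [exact: (@above_nth 0 k_list)|exact: (@above_nth 1 k_list)
    |exact: (@above_nth 2 k_list)|exact: (@above_nth 3 k_list)].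
apply/orP; right; case: h => [[/isubbT a b]|h].
  apply/orP; left; apply/andP; split=> //.
  by case: b => [|[|]]; [exact: (@above_nth 0 l_list)|exact: (@above_nth 1 l_list)|exact: (@above_nth 2 l_list)].
apply/orP; right; case: h => [[/isubbT a /isubbT b]|h]; first by apply/orP; left; apply/andP.
apply/orP; right; case: h => [[/isubbT a b]|h].
  apply/orP; left; apply/andP; split=> //.
  by case: b => [|[|]]; [exact: (@above_nth 0 n_list)|exact: (@above_nth 1 n_list)|exact: (@above_nth 2 n_list)].
apply/orP; right; case: h => [[/isubbT a b]|[/isubbT a /isubbT b]]; last by apply/orP; right; apply/andP.
apply/orP; left; apply/andP; split=> //.
by case: b => [|[|[|]]]; [exact: (@above_nth 0 o_list)|exact: (@above_nth 1 o_list)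
    |exact: (@above_nth 2 o_list)|exact: (@above_nth 3 o_list)].
Qed.

Lemma isubb_isol X A Z : iso X A -> isubb X Z = isubb A Z.
Proof.
move=> h; apply/isubP/isubP; apply: isub_trans; apply: iso_isub => //; exact: iso_sym.
Qed.

Lemma isubb_isor X A Z : iso X A -> isubb Z X = isubb Z A.
Proof.
by move=> h; apply/isubP/isubP => k; apply: isub_trans k _; apply: iso_isub => //; exact: iso_sym.
Qed.

Lemma psfb_iso X A : iso X A -> psfb X = psfb A.
Proof.
move=> h; apply: eq_has => lss; apply/isoP/isoP; apply: iso_trans => //; exact: iso_sym.
Qed.

Lemma above_iso As X A : iso X A -> above As X = above As A.
Proof. by move=> h; apply: eq_has => B; apply: isubb_isor. Qed.

Lemma condb_iso X Y A B : iso X A -> iso Y B -> condb X Y = condb A B.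
Proof.
move=> hX hY; have cX := iso_compl hX; have cY := iso_compl hY.
rewrite /condb !(isubb_isol _ hX) !(isubb_isol _ hY) !(isubb_isor _ hX) !(isubb_isor _ hY).
by rewrite !(isubb_isor _ cX) (psfb_iso hX) (psfb_iso hY) (psfb_iso cX) (psfb_iso cY) !(above_iso _ hY).
Qed.

(** The two paw pairs come first, so each K_3 pair stands two places after its paw partner. *)
Definition open_orbit : seq (graph * graph) :=
  let base := [:: (paw, P 7), (paw, S 1 2 3) & open_pairs] in
  let sides := base ++ [seq (compl q.1, compl q.2) | q <- base] in
  sides ++ [seq (q.2, q.1) | q <- sides].

Definition matches (q r : graph * graph) : bool := isob q.1 r.1 && isob q.2 r.2.
Definition orbit_nth (i : nat) : graph * graph := nth (gempty, gempty) open_orbit i.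

Definition in_orbit (q : graph * graph) : Prop :=
  exists2 i, i < size open_orbit & matches q (orbit_nth i).

Lemma in_orbit_iso X Y A B : iso X A -> iso Y B -> in_orbit (A, B) -> in_orbit (X, Y).
Proof.
move=> hX hY [i hi /andP[/isoP a /isoP b]]; exists i => //.
by apply/andP; split; apply/isoP; apply: iso_trans; eassumption.
Qed.

(* The list has four blocks of eight pairs: complementation exchanges blocks
   0, 1 and blocks 2, 3, and swapping exchanges the two halves. *)
Lemma open_orbit_closed : all (fun i => let q := orbit_nth i in
  [&& matches (compl q.1, compl q.2) (orbit_nth (if odd (i %/ 8) then i - 8 else i + 8)),
      matches (q.2, q.1) (orbit_nth ((i + 16) %% 32)),
      isob q.1 (K 3) ==> matches (paw, q.2) (orbit_nth (i - 2)) &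
      isob q.1 paw ==> matches (K 3, q.2) (orbit_nth (i + 2))]) (iota 0 32).
Proof. by vm_compute. Qed.

Lemma open_orbit_no_condb : all (fun q => ~~ condb q.1 q.2) open_orbit.
Proof. by vm_compute. Qed.

(** Out of range [orbit_nth] is a pair of empty graphs, so a nonempty match proves the index valid
    without any arithmetic on it. *)
Lemma matches_in_orbit q i : matches q (orbit_nth i) -> 0 < nv q.1 -> in_orbit q.
Proof.
move=> h h0; case: (ltnP i (size open_orbit)) => hi; first by exists i.
by move: h; rewrite /matches /orbit_nth nth_default // /isob /= -leqn0 leqNgt h0.
Qed.

Lemma in_orbit_nv q : in_orbit q -> 0 < nv q.1 /\ 0 < nv q.2.
Proof.
have pos : all (fun r => (0 < nv r.1) && (0 < nv r.2)) open_orbit by vm_compute.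
case=> i hi /andP[/andP[/andP[/eqP-> _] _] /andP[/andP[/eqP-> _] _]].
by have /andP := all_nthP (gempty, gempty) pos i hi.
Qed.

Lemma in_orbit_step q r : pair_step q r -> in_orbit q -> in_orbit r.
Proof.
have refl_iso G : iso G G := isub_anti_iso (isub_refl G) (isub_refl G).
case=> [X Y A B hX hY|X Y|X Y|X Y hX|X Y hX] h; first by apply: in_orbit_iso h; apply: iso_sym.
all: have [p1 p2] := in_orbit_nv h; case: h => i hi /andP[/isoP a /isoP b].
all: have /andP[n1 n2] : (0 < nv (orbit_nth i).1) && (0 < nv (orbit_nth i).2)
  by move: (isub_nv (iso_isub a)) (isub_nv (iso_isub b)) p1 p2 => /=; lia.
all: have /and4P[h1 h2 h3 h4] := allP open_orbit_closed i ltac:(by rewrite mem_iota).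
- exact: in_orbit_iso b a (matches_in_orbit h2 n2).
- by apply: in_orbit_iso (matches_in_orbit h1 n1); apply: iso_compl.
- apply: (in_orbit_iso (refl_iso _) b); apply: matches_in_orbit (implyP h3 _) _ => //.
  by apply/isoP; apply: iso_trans (iso_sym a) hX.
apply: (in_orbit_iso (refl_iso _) b); apply: matches_in_orbit (implyP h4 _) _ => //.
by apply/isoP; apply: iso_trans (iso_sym a) hX.
Qed.

Lemma in_orbit_equiv q r : pair_equiv q r -> in_orbit q -> in_orbit r.
Proof. by elim=> // [x y /in_orbit_step|x y z _ h1 _ h2 /h1/h2]. Qed.

Lemma in_orbit_no_cond X Y : in_orbit (X, Y) -> ~ cond X Y.
Proof.
case=> i hi /andP[/isoP a /isoP b] /condP; rewrite (condb_iso a b).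
exact/negP/(all_nthP (gempty, gempty) open_orbit_no_condb).
Qed.

(** The closure is of directed steps, but each one is undone up to isomorphism by another. The orbit
    is entered at the open pair, so the given equivalence has to be reversed. *)
Lemma pair_equiv_sym q r : pair_equiv q r -> pair_equiv r q.
Proof.
have refl_iso G : iso G G := isub_anti_iso (isub_refl G) (isub_refl G).
elim=> [x y|x|x y z _ h1 _ h2]; [|exact: rt_refl|exact: rt_trans h2 h1].
case=> [X Y A B hX hY|X Y|X Y|X Y hX|X Y hX].
- by apply/rt_step/ps_iso; apply: iso_sym.
- exact/rt_step/ps_swap.
- apply: rt_trans (rt_step _ _ _ _ (ps_compl _ _)) (rt_step _ _ _ _ (ps_iso _ _)); exact: iso_complK.
- apply: rt_trans (rt_step _ _ _ _ (ps_pawK3 _ _)) (rt_step _ _ _ _ (ps_iso _ _)) => //; exact: iso_sym.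
apply: rt_trans (rt_step _ _ _ _ (ps_K3paw _ _)) (rt_step _ _ _ _ (ps_iso _ _)) => //; exact: iso_sym.
Qed.

Lemma open_in_orbit A B : inP (A, B) open_pairs -> in_orbit (A, B).
Proof.
have h i : i < size open_orbit -> in_orbit (orbit_nth i).
  have refl_iso G : iso G G := isub_anti_iso (isub_refl G) (isub_refl G).
  by move=> hi; exists i => //; apply/andP; split; apply/isoP.
case=> [[-> ->]|]; first exact: (h 2).
case=> [[-> ->]|]; first exact: (h 3).
case=> [[-> ->]|]; first exact: (h 4).
case=> [[-> ->]|]; first exact: (h 5).
case=> [[-> ->]|]; first exact: (h 6).
by case=> // -[-> ->]; exact: (h 7).
Qed.

Theorem theorem11 (H1 H2 : graph) :
  (~ exists H3 H4, pair_equiv (H1, H2) (H3, H4) /\ cond H3 H4) <->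
  (exists A B, inP (A, B) open_pairs /\ pair_equiv (H1, H2) (A, B)).
Proof.
split=> [h|[A [B [hO hE]]] [H3 [H4 [e c]]]].
  by apply: no_cond_open => H3 H4 e c; apply: h; exists H3, H4.
apply: (@in_orbit_no_cond H3 H4) c.
exact: in_orbit_equiv e (in_orbit_equiv (pair_equiv_sym hE) (open_in_orbit hO)).
Qed.
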